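(* Let $p$ be a prime number, let $n \ge 2$ be an integer and let $\lambda > 1$ be a real number. Then $$\dim \{ \xi \in \mathbb{Q}_p : \lambda_n (\xi) \ge \lambda\} = \dim \{ \xi \in \mathbb{Q}_p : \lambda_n (\xi) = \lambda\} = \frac{2}{n(1 + \lambda)}.$$
   Context: $|\cdot|_p$ is the usual $p$-adic absolute value on $\mathbb{Q}_p$, normalized by $|p|_p=p^{-1}$, and $\dim$ denotes Hausdorff dimension in $\mathbb{Q}_p$ for the metric $|x-y|_p$. For an integer $n\ge 1$ and $\xi\in\mathbb{Q}_p$, $\lambda_n(\xi)\in[-\infty,+\infty]$ denotes the supremum of the real numbers $\lambda$ such that, for arbitrarily large real numbers $X$, the inequalities $$\max\{|x_0|,\ldots,|x_n|\}\le X,\qquad 0<\max_{1\le m\le n}|x_0\xi^m-x_m|_p\le X^{-\lambda-1}$$ have a solution in integers $x_0,\ldots,x_n$. *)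

(* Defs.v *)
From HB Require Import structures.
From mathcomp Require Import all_boot all_order all_algebra.
From mathcomp Require Import generic_quotient ring_quotient ring lra.
From mathcomp Require Import all_classical all_reals all_analysis.

Set Implicit Arguments.
Unset Strict Implicit.
Unset Printing Implicit Defensive.
Import Order.TTheory GRing.Theory Num.Theory.
Import numFieldNormedType.Exports.
Local Open Scope classical_set_scope.
Local Open Scope ring_scope.

Section PadicAbs.
Variables (R : realType) (p : nat).
Implicit Types (x y : rat) (a b : int).

(* p ^ (- v_p x).  For p not prime, logn p is 0 by convention, so that this is
   the trivial absolute value; hence the absolute-value laws below, and the
   field structure of Qp, need no primality hypothesis. *)
Definition padic_abs x : R :=
  if x == 0 then 0
  else p%:R ^+ logn p `|denq x|%N / p%:R ^+ logn p `|numq x|%N.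

Let iabs a : R := if a == 0 then 0 else (p%:R ^+ logn p `|a|%N)^-1.

Let pX_gt0 m : 0 < p%:R ^+ logn p m :> R.
Proof.
case: (posnP p) => [->|p0]; first by rewrite lognE /= expr0.
by rewrite exprn_gt0 // ltr0n.
Qed.

Let iabs_gt0 a : a != 0 -> 0 < iabs a.
Proof. by move=> a0; rewrite /iabs (negbTE a0) invr_gt0. Qed.

Let iabs0 : iabs 0 = 0. Proof. by rewrite /iabs eqxx. Qed.

Let iabsM a b : iabs (a * b) = iabs a * iabs b.
Proof.
rewrite /iabs mulf_eq0; case: eqP => [|/eqP a0]; first by rewrite mul0r.
case: eqP => [|/eqP b0] /=; first by rewrite mulr0.
by rewrite abszM lognM ?absz_gt0 // exprD invfM.
Qed.

Let padic_absE x : padic_abs x = iabs (numq x) / iabs (denq x).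
Proof.
rewrite /padic_abs /iabs numq_eq0 (negbTE (denq_neq0 x)).
by case: eqP => _; [rewrite mul0r | rewrite invrK mulrC].
Qed.

Let padic_abs_frac a b : b != 0 ->
  padic_abs (a%:~R / b%:~R) = iabs a / iabs b.
Proof.
move=> b0; set x := _ / _; rewrite padic_absE.
have bq0 : b%:~R != 0 :> rat by rewrite intr_eq0.
have dq0 : (denq x)%:~R != 0 :> rat by rewrite intr_eq0 denq_neq0.
have : (numq x * b = a * denq x)%R.
  apply: (@intr_inj rat); rewrite !rmorphM /=.
  by apply/eqP; rewrite -eqr_div // divq_num_den.
move=> /(congr1 iabs); rewrite !iabsM => e.
by apply/eqP; rewrite eqr_div ?e // ?gt_eqF ?iabs_gt0 ?denq_neq0.
Qed.

Let iabs_le_max a b : iabs (a + b) <= Num.max (iabs a) (iabs b).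
Proof.
wlog ab : a b / iabs b <= iabs a => [H|].
  have /orP[/H //|/H] := le_total (iabs b) (iabs a).
  by rewrite addrC maxC.
rewrite max_l //.
have [a0|a0] := eqVneq a 0.
  by move: ab; rewrite a0 add0r.
have [->|ab0] := eqVneq (a + b) 0; first by rewrite iabs0 ltW // iabs_gt0.
have [->|b0] := eqVneq b 0; first by rewrite addr0.
move: ab; rewrite /iabs (negbTE a0) (negbTE b0) (negbTE ab0).
rewrite !lef_pV2 ?posrE //.
have [pp|npp] := boolP (prime p); last first.
  have l0 m : logn p m = 0%N by rewrite lognE (negbTE npp).
  by rewrite !l0.
have p1 : 1 < p%:R :> R by rewrite ltr1n prime_gt1.
rewrite !ler_eXn2l // => lab.
rewrite -pfactor_dvdn ?absz_gt0 //.
have da : ((p ^ logn p `|a|)%N %| a)%Z.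
  by rewrite intdiv.dvdzE absz_nat pfactor_dvdnn.
have db : ((p ^ logn p `|a|)%N %| b)%Z.
  by rewrite intdiv.dvdzE absz_nat pfactor_dvdn ?absz_gt0.
by have := rpredD da db; rewrite intdiv.dvdzE absz_nat.
Qed.

Lemma padic_abs0 : padic_abs 0 = 0.
Proof. by rewrite /padic_abs eqxx. Qed.

Lemma padic_abs_ge0 x : 0 <= padic_abs x.
Proof.
by rewrite /padic_abs; case: eqP => // _; rewrite divr_ge0 // ltW.
Qed.

Lemma padic_abs_eq0 x : (padic_abs x == 0) = (x == 0).
Proof.
rewrite /padic_abs; case: (x == 0); first exact: eqxx.
by rewrite gt_eqF // divr_gt0.
Qed.

Lemma padic_absM x y : padic_abs (x * y) = padic_abs x * padic_abs y.
Proof.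
rewrite -{1}(divq_num_den x) -{1}(divq_num_den y) mulf_div -!rmorphM /=.
rewrite padic_abs_frac ?mulf_neq0 ?denq_neq0 //.
by rewrite !padic_absE !iabsM mulf_div.
Qed.

Lemma padic_absN x : padic_abs (- x) = padic_abs x.
Proof. by rewrite /padic_abs oppr_eq0 numqN denqN abszN. Qed.

Lemma padic_abs1 : padic_abs 1 = 1.
Proof. by rewrite /padic_abs oner_eq0 /= logn1 expr0 divr1. Qed.

Lemma padic_absV x : padic_abs x^-1 = (padic_abs x)^-1.
Proof.
have [->|x0] := eqVneq x 0; first by rewrite invr0 padic_abs0 invr0.
have ax0 : padic_abs x != 0 by rewrite padic_abs_eq0.
by apply: (mulfI ax0); rewrite -padic_absM !mulfV // padic_abs1.
Qed.

Lemma padic_absp : prime p -> padic_abs p%:R = p%:R^-1.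
Proof.
move=> pp; have -> : p%:R = (p : int)%:~R / (1 : int)%:~R :> rat.
  by rewrite divr1.
rewrite padic_abs_frac // /iabs /= logn1 expr0 invr1 divr1 eqz_nat.
by rewrite eqn0Ngt prime_gt0 // logn_prime // eqxx expr1.
Qed.

Lemma padic_abs_maxD x y :
  padic_abs (x + y) <= Num.max (padic_abs x) (padic_abs y).
Proof.
have dx := denq_neq0 x; have dy := denq_neq0 y.
have dxq : (denq x)%:~R != 0 :> rat by rewrite intr_eq0.
have dyq : (denq y)%:~R != 0 :> rat by rewrite intr_eq0.
have i0 := iabs_gt0 dx; have j0 := iabs_gt0 dy.
rewrite -{1}(divq_num_den x) -{1}(divq_num_den y) addf_div //.
have ij0 : 0 < iabs (denq x) * iabs (denq y) by rewrite mulr_gt0.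
rewrite -!rmorphM -rmorphD padic_abs_frac ?mulf_neq0 //.
rewrite iabsM ler_pdivrMr // (le_trans (iabs_le_max _ _)) //.
rewrite !iabsM !padic_absE maxr_pMl; last exact: ltW.
by rewrite mulrA divfK ?gt_eqF // (mulrC (iabs (denq x))) mulrA divfK ?gt_eqF.
Qed.

Lemma padic_abs_triangle x y :
  padic_abs (x + y) <= padic_abs x + padic_abs y.
Proof.
rewrite (le_trans (padic_abs_maxD _ _)) // ge_max lerDl lerDr.
by rewrite !padic_abs_ge0.
Qed.

Lemma padic_abs_dist x y :
  `|padic_abs x - padic_abs y| <= padic_abs (x - y).
Proof.
have := padic_abs_triangle (x - y) y; have := padic_abs_triangle (y - x) x.
by rewrite !subrK -(opprB x y) padic_absN ler_norml => ? ?; apply/andP; lra.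
Qed.

End PadicAbs.

Section PadicCauchy.
Variables (R : realType) (p : nat).
Local Notation abs := (@padic_abs R p).
Implicit Types u v : nat -> rat.

Definition padic_cauchy : {pred nat -> rat} := fun u =>
  `[< forall e : R, 0 < e -> exists N, forall m n,
        (N <= m)%N -> (N <= n)%N -> abs (u m - u n) < e >].

Lemma padic_cauchyP u : reflect (forall e : R, 0 < e -> exists N, forall m n,
  (N <= m)%N -> (N <= n)%N -> abs (u m - u n) < e) (u \in padic_cauchy).
Proof. exact: asboolP. Qed.

Lemma padic_cauchy_bounded u : u \in padic_cauchy ->
  exists M N, 0 < M /\ forall n, (N <= n)%N -> abs (u n) < M.
Proof.
move=> /padic_cauchyP /(_ _ ltr01)[N uN].
exists (abs (u N) + 1), N; split=> [|n Nn].
  by rewrite ltr_wpDl // padic_abs_ge0.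
rewrite -(subrK (u N) (u n)) (le_lt_trans (padic_abs_triangle _ _ _ _)) //.
by rewrite addrC ltrD2l uN.
Qed.

Lemma padic_cauchy_subring : subring_closed padic_cauchy.
Proof.
split=> [|u v /padic_cauchyP uC /padic_cauchyP vC|u v uC vC].
- by apply/padic_cauchyP => e e0; exists 0%N => m n _ _; rewrite subrr padic_abs0.
- apply/padic_cauchyP => e e0; have e20 : 0 < e / 2 by rewrite divr_gt0.
  have [N uN] := uC _ e20; have [M vM] := vC _ e20.
  exists (maxn N M) => m n; rewrite !geq_max => /andP[Nm Mm] /andP[Nn Mn].
  rewrite /= !fctE (_ : _ - _ = (u m - u n) + (v n - v m)); last by ring.
  rewrite (le_lt_trans (padic_abs_triangle _ _ _ _)) //.
  by rewrite [ltRHS]splitr ltrD // ?uN ?vM.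
- have [A [N1 [A0 uA]]] := padic_cauchy_bounded uC.
  have [B [N2 [B0 vB]]] := padic_cauchy_bounded vC.
  apply/padic_cauchyP => e e0.
  have [|N uN] := padic_cauchyP _ uC (e / 2 / B); first by rewrite !divr_gt0.
  have [|M vM] := padic_cauchyP _ vC (e / 2 / A); first by rewrite !divr_gt0.
  exists (maxn (maxn N1 N2) (maxn N M)) => m n; rewrite !geq_max.
  move=> /andP[/andP[N1m N2m] /andP[Nm Mm]] /andP[/andP[N1n N2n] /andP[Nn Mn]].
  rewrite /= !fctE.
  rewrite (_ : _ - _ = (u m - u n) * v m + (v m - v n) * u n); last by ring.
  rewrite (le_lt_trans (padic_abs_triangle _ _ _ _)) // [ltRHS]splitr !padic_absM.
  have h (a b C : R) : 0 < C -> 0 <= a -> 0 <= b -> a < e / 2 / C -> b < C ->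
      a * b < e / 2.
    move=> C0 a0 b0 ae bC; rewrite -(divfK (lt0r_neq0 C0) (e / 2)).
    exact: ltr_pM.
  by apply: ltrD; [apply: (h _ _ B)|apply: (h _ _ A)];
    rewrite ?padic_abs_ge0 ?uN ?vM ?uA ?vB.
Qed.

HB.instance Definition _ := GRing.isSubringClosed.Build (nat -> rat)
  padic_cauchy padic_cauchy_subring.

Record padic_seq := PadicSeq {
  padic_seq_val :> nat -> rat;
  padic_seqP : padic_seq_val \in padic_cauchy }.

HB.instance Definition _ := [isSub for padic_seq_val].
HB.instance Definition _ := [Choice of padic_seq by <:].
HB.instance Definition _ := [SubChoice_isSubComNzRing of padic_seq by <:].

Implicit Types s t : padic_seq.

Definition padic_seq_norm s : R := limn (fun n => abs (s n)).

Lemma padic_seq_cvg s : abs (s n) @[n --> \oo] --> padic_seq_norm s.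
Proof.
apply/cauchy_cvgP/cauchy_exP => e e0.
have [N sN] := padic_cauchyP _ (padic_seqP s) e e0.
exists (abs (s N)), N => // n Nn; rewrite /ball /=.
by apply: (le_lt_trans (padic_abs_dist _ _ _ _)); apply: sN.
Qed.

Lemma padic_seq_norm_ge0 s : 0 <= padic_seq_norm s.
Proof.
apply: cvgr_to_ge (@padic_seq_cvg s) _.
by near=> n; exact: padic_abs_ge0.
Unshelve. all: by end_near. Qed.

Lemma padic_seq_normE s l : abs (s n) @[n --> \oo] --> l ->
  padic_seq_norm s = l.
Proof. by move=> sl; apply: cvg_lim. Qed.

Lemma padic_seq_norm0 : padic_seq_norm 0 = 0.
Proof.
apply: padic_seq_normE; rewrite [X in X @ _](_ : _ = cst 0); first exact: cvg_cst.
by apply/funext => n; exact: padic_abs0.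
Qed.

Lemma padic_seq_norm1 : padic_seq_norm 1 = 1.
Proof.
apply: padic_seq_normE; rewrite [X in X @ _](_ : _ = cst 1); first exact: cvg_cst.
by apply/funext => n; exact: padic_abs1.
Qed.

Lemma padic_seq_normN s : padic_seq_norm (- s) = padic_seq_norm s.
Proof.
apply: padic_seq_normE => /=.
rewrite [X in X @ _](_ : _ = fun n => abs (s n)); last first.
  by apply/funext => n; exact: padic_absN.
exact: padic_seq_cvg.
Qed.

Lemma padic_seq_normM s t :
  padic_seq_norm (s * t) = padic_seq_norm s * padic_seq_norm t.
Proof.
apply: padic_seq_normE => /=.
rewrite [X in X @ _](_ : _ = fun n => abs (s n) * abs (t n)); last first.
  by apply/funext => n; exact: padic_absM.
by apply: cvgM; exact: padic_seq_cvg.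
Qed.

Lemma padic_seq_norm_maxD s t : padic_seq_norm (s + t) <=
  Num.max (padic_seq_norm s) (padic_seq_norm t).
Proof.
apply/ler_addgt0Pl => e e0.
apply: cvgr_to_le (@padic_seq_cvg (s + t)) _.
near=> n; rewrite (le_trans (padic_abs_maxD _ _ _ _)) // addr_maxr.
rewrite ge_max !le_max; apply/andP; split; apply/orP; [left|right].
  near: n; apply: (cvgr_le _ (@padic_seq_cvg s)); lra.
near: n; apply: (cvgr_le _ (@padic_seq_cvg t)); lra.
Unshelve. all: by end_near. Qed.

Definition padic_null : {pred padic_seq} := [pred s | padic_seq_norm s == 0].

Lemma padic_null_idealr : idealr_closed padic_null.
Proof.
split=> [||a s t]; rewrite !inE ?padic_seq_norm0 ?padic_seq_norm1 ?oner_eq0 //.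
move=> /eqP s0 /eqP t0; rewrite eq_le padic_seq_norm_ge0 andbT.
rewrite (le_trans (padic_seq_norm_maxD _ _)) //.
by rewrite padic_seq_normM s0 t0 mulr0 maxxx.
Qed.

HB.instance Definition _ := isIdealr.Build padic_seq padic_null
  padic_null_idealr.

(* The completion of the rationals; the parameter R only serves as the codomain
   of the absolute value. *)
Definition Qp := {ideal_quot padic_null}.

HB.instance Definition _ := GRing.ComNzRing.on Qp.

End PadicCauchy.

Section PadicField.
Variables (R : realType) (p : nat).
Local Notation K := (Qp R p).
Local Notation seqn := (@padic_seq_norm R p).
Local Open Scope quotient_scope.
Implicit Types (x y : K) (s t : padic_seq R p).

Let pi0 : \pi_K 0 = 0. Proof. by rewrite !piE. Qed.
Let pi1 : \pi_K 1 = 1. Proof. by rewrite !piE. Qed.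

Definition padic_norm x : R := seqn (repr x).

Lemma padic_norm_pi s : padic_norm (\pi_K s) = seqn s.
Proof.
have /eqP : repr (\pi_K s) = s %[mod K] by rewrite reprK.
rewrite -Quotient.idealrBE inE => /eqP d0.
have h a b : seqn (a - b) = 0 -> seqn a <= seqn b.
  move=> ab0; rewrite -{1}(subrK b a) (le_trans (padic_seq_norm_maxD _ _)) //.
  by rewrite ab0 ge_max padic_seq_norm_ge0 lexx.
by apply/eqP; rewrite eq_le !h // -opprB padic_seq_normN.
Qed.

Lemma padic_norm_ge0 x : 0 <= padic_norm x.
Proof. exact: padic_seq_norm_ge0. Qed.

Lemma padic_norm_eq0 x : (padic_norm x == 0) = (x == 0).
Proof.
rewrite -[x]reprK padic_norm_pi -pi0.
by rewrite -Quotient.idealrBE subr0.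
Qed.

Lemma padic_norm0 : padic_norm 0 = 0.
Proof. by apply/eqP; rewrite padic_norm_eq0. Qed.

Lemma padic_normM x y : padic_norm (x * y) = padic_norm x * padic_norm y.
Proof.
rewrite -[x]reprK -[y]reprK -[_ * _]Quotient.pi_mul !padic_norm_pi.
exact: padic_seq_normM.
Qed.

Lemma padic_normN x : padic_norm (- x) = padic_norm x.
Proof.
by rewrite -[x]reprK -[- _]Quotient.pi_opp !padic_norm_pi padic_seq_normN.
Qed.

Lemma padic_norm_maxD x y :
  padic_norm (x + y) <= Num.max (padic_norm x) (padic_norm y).
Proof.
rewrite -[x]reprK -[y]reprK -[_ + _]Quotient.pi_add !padic_norm_pi.
exact: padic_seq_norm_maxD.
Qed.

Lemma padic_inv_ex x : x != 0 -> exists y, y * x = 1.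
Proof.
rewrite -padic_norm_eq0 => x0; set s := repr x.
have s0 : 0 < seqn s by rewrite lt_def x0 padic_seq_norm_ge0.
set c := seqn s / 2; have c0 : 0 < c by rewrite divr_gt0.
have [N _ sc] : \forall n \near \oo, c < padic_abs R p (s n).
  apply: (cvgr_gt (seqn s) (@padic_seq_cvg _ _ s)).
  by rewrite ltr_pdivrMr // ltr_pMr // ltr1n.
have tC : (fun n => (s n)^-1) \in padic_cauchy R p.
  apply/padic_cauchyP => e e0.
  have [|M sM] := padic_cauchyP _ _ _ (padic_seqP s) (e * (c * c)).
    by rewrite !mulr_gt0.
  exists (maxn N M) => m n; rewrite !geq_max => /andP[Nm Mm] /andP[Nn Mn].
  have cm : c < padic_abs R p (s m) := sc _ Nm.
  have cn : c < padic_abs R p (s n) := sc _ Nn.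
  have am0 := lt_trans c0 cm; have an0 := lt_trans c0 cn.
  have sm0 : s m != 0 by rewrite -(padic_abs_eq0 R p) gt_eqF.
  have sn0 : s n != 0 by rewrite -(padic_abs_eq0 R p) gt_eqF.
  rewrite (_ : _ - _ = (s n - s m) / (s m * s n)); last by field; rewrite sm0 sn0.
  have cc : c * c < padic_abs R p (s m) * padic_abs R p (s n).
    by rewrite ltr_pM // ltW.
  rewrite padic_absM padic_absV padic_absM ltr_pdivrMr; last first.
    by rewrite (lt_trans _ cc) ?mulr_gt0.
  by rewrite (lt_trans (sM _ _ Mn Mm)) // ltr_pM2l.
exists (\pi_K (PadicSeq tC)).
rewrite -[x]reprK -[_ * _]Quotient.pi_mul -pi1.
apply/eqP; rewrite -Quotient.idealrBE inE; apply/eqP.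
apply: padic_seq_normE; apply: cvg_near_cst; exists N => // n Nn.
apply/eqP; rewrite padic_abs_eq0 subr_eq0; apply/eqP; apply: mulVf.
by rewrite -(padic_abs_eq0 R p) gt_eqF //; apply: lt_trans c0 _; exact: sc.
Qed.

Definition padic_inv x : K := xget 0 [set y | y * x = 1].

Lemma padic_mulVf x : x != 0 -> padic_inv x * x = 1.
Proof. by move=> /padic_inv_ex; exact: xgetPex. Qed.

Lemma padic_invr0 : padic_inv 0 = 0.
Proof.
apply: xgetPN => y /= /eqP; apply/negP.
by rewrite mulr0 eq_sym oner_eq0.
Qed.

HB.instance Definition _ :=
  GRing.ComNzRing_isField.Build K padic_mulVf padic_invr0.

Definition padic_dist x y : R := padic_norm (x - y).

Lemma padic_distxx x : padic_dist x x = 0.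
Proof. by rewrite /padic_dist subrr padic_norm0. Qed.

Lemma padic_dist_positivity x y : padic_dist x y = 0 -> x = y.
Proof. by move/eqP; rewrite padic_norm_eq0 subr_eq0 => /eqP. Qed.

Lemma padic_dist_sym x y : padic_dist x y = padic_dist y x.
Proof. by rewrite /padic_dist -opprB padic_normN. Qed.

Lemma padic_dist_ultra y x z :
  padic_dist x z <= Num.max (padic_dist x y) (padic_dist y z).
Proof. by rewrite (le_trans _ (padic_norm_maxD _ _)) // addrA subrK. Qed.

Lemma padic_dist_triangle y x z :
  padic_dist x z <= padic_dist x y + padic_dist y z.
Proof.
rewrite (le_trans (padic_dist_ultra y _ _)) // ge_max lerDl lerDr.
by rewrite !padic_norm_ge0.
Qed.

HB.instance Definition _ := isMetric.Build R K padic_distxx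
  padic_dist_positivity padic_dist_sym padic_dist_triangle.
HB.instance Definition _ := isPointed.Build K 0.

End PadicField.

Section PadicComplete.
Variables (R : realType) (p : nat).
Local Notation K := (Qp R p).
Local Notation norm := (@padic_norm R p).
Local Open Scope quotient_scope.
Implicit Types (x y : K) (q : rat).

Let cst_cauchy q : (fun=> q) \in padic_cauchy R p.
Proof.
by apply/padic_cauchyP => e e0; exists 0%N => m n _ _; rewrite subrr padic_abs0.
Qed.

Definition padic_of_rat q : K := \pi_K (PadicSeq (cst_cauchy q)).

Let padic_of_rat_is_zmod_morphism : zmod_morphism padic_of_rat.
Proof.
move=> q r; rewrite /padic_of_rat -[- _ in RHS]Quotient.pi_opp.
rewrite -[_ + _ in RHS]Quotient.pi_add; congr (\pi_K _); exact: val_inj.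
Qed.

Let padic_of_rat_is_monoid_morphism : monoid_morphism padic_of_rat.
Proof.
split=> [|q r]; rewrite /padic_of_rat.
  transitivity (\pi_K 1); last by rewrite !piE.
  congr (\pi_K _); exact: val_inj.
rewrite -[_ * _ in RHS]Quotient.pi_mul; congr (\pi_K _); exact: val_inj.
Qed.

HB.instance Definition _ := GRing.isZmodMorphism.Build rat K padic_of_rat
  padic_of_rat_is_zmod_morphism.
HB.instance Definition _ := GRing.isMonoidMorphism.Build rat K padic_of_rat
  padic_of_rat_is_monoid_morphism.

Lemma padic_norm_ratr q : norm (ratr q) = padic_abs R p q.
Proof.
rewrite -(fmorph_eq_rat padic_of_rat) padic_norm_pi.
apply: padic_seq_normE.
rewrite [X in X @ _](_ : _ = cst (padic_abs R p q)) //; exact: cvg_cst.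
Qed.

Lemma padic_norm_intr (a : int) : norm a%:~R = padic_abs R p a%:~R.
Proof. by rewrite -padic_norm_ratr ratr_int. Qed.

Lemma padic_dist_le (s : padic_seq R p) q e (N : nat) :
  (forall n, (N <= n)%N -> padic_abs R p (s n - q) <= e) ->
  norm ((\pi_K s : K) - ratr q) <= e.
Proof.
move=> sq; rewrite -(fmorph_eq_rat padic_of_rat).
have -> : (\pi_K s : K) - padic_of_rat q =
    \pi_K (s - PadicSeq (cst_cauchy q)).
  by rewrite [RHS]Quotient.pi_add Quotient.pi_opp.
rewrite padic_norm_pi.
by apply: cvgr_to_le (@padic_seq_cvg _ _ _) _; exists N => // n; exact: sq.
Qed.

Lemma padic_dense x (e : R) : 0 < e -> exists q, norm (x - ratr q) < e.
Proof.
move=> e0; have e20 : 0 < e / 2 by rewrite divr_gt0.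
have [N sN] := padic_cauchyP _ _ _ (padic_seqP (repr x)) (e / 2) e20.
exists (repr x N); rewrite -{1}[x]reprK.
apply: (@le_lt_trans _ _ (e / 2)); last by rewrite ltr_pdivrMr // ltr_pMr // ltr1n.
by apply: (padic_dist_le (N := N)) => n Nn; rewrite ltW // sN.
Qed.

Lemma padic_complete (F : set_system K) : ProperFilter F -> cauchy F -> cvg F.
Proof.
move=> FF Fc.
have /choice[q qF] : forall k : nat, exists q,
    F [set y | norm (ratr q - y) < k.+1%:R^-1].
  move=> k; have k0 : 0 < k.+1%:R^-1 :> R by rewrite invr_gt0.
  have [x xF] := (cauchyP F).1 Fc _ k0; have [q xq] := padic_dense x k0.
  exists q; apply: filterS xF => y; rewrite ballEmdist /= => xy.
  apply: le_lt_trans (padic_dist_ultra x _ _) _.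
  by rewrite gt_max padic_dist_sym xq.
have qd k l : padic_abs R p (q k - q l) < Num.max k.+1%:R^-1 l.+1%:R^-1.
  have [y [yk yl]] := filter_ex (filterI (qF k) (qF l)).
  have {}yk : padic_dist (ratr (q k)) y < k.+1%:R^-1 := yk.
  have {}yl : padic_dist y (ratr (q l)) < l.+1%:R^-1.
    by rewrite padic_dist_sym; exact: yl.
  rewrite -padic_norm_ratr -(fmorph_eq_rat padic_of_rat) rmorphB !fmorph_eq_rat.
  apply: le_lt_trans (padic_dist_ultra y _ _) _.
  by rewrite gt_max; apply/andP; split; rewrite lt_max ?yk ?yl ?orbT.
have inv_small (e : R) : 0 < e -> exists N : nat,
    forall n, (N <= n)%N -> n.+1%:R^-1 < e.
  move=> e0; have [N _ h] := near_infty_natSinv_lt (PosNum e0).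
  by exists N => n /h.
have qC : q \in padic_cauchy R p.
  apply/padic_cauchyP => e /inv_small[N Ne]; exists N => m n Nm Nn.
  by rewrite (lt_trans (qd _ _)) // gt_max !Ne.
apply/cvg_ex; exists (\pi_K (PadicSeq qC)).
apply/metricType_numDomainType.fcvgrPdist_lt => e e0.
have e20 : 0 < e / 2 by rewrite divr_gt0.
have e2e : e / 2 < e by rewrite ltr_pdivrMr // ltr_pMr // ltr1n.
have [N Ne] := inv_small _ e20; apply: filterS (qF N) => y qy.
apply: le_lt_trans (padic_dist_ultra (ratr (q N)) _ _) _.
rewrite gt_max; apply/andP; split; last first.
  exact: lt_trans qy (lt_trans (Ne _ (leqnn N)) e2e).
apply: le_lt_trans e2e; apply: (padic_dist_le (N := N)) => n Nn.
by rewrite ltW // (lt_trans (qd _ _)) // gt_max !Ne.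
Qed.

HB.instance Definition _ := Uniform_isComplete.Build K padic_complete.

End PadicComplete.

Lemma padic_mdistE (R : realType) (p : nat) (x y : Qp R p) :
  mdist x y = padic_norm (x - y).
Proof. by []. Qed.

Section Hausdorff.
Variables (R : realType) (T : metricType R).
Local Open Scope ereal_scope.
Implicit Types (A E : set T) (s delta : R).

Definition diameter A : \bar R :=
  ereal_sup [set d | exists x y, [/\ A x, A y & d = (mdist x y)%:E]].

(* The empty set (of diameter -oo here) contributes 0 for every s; a nonempty
   set contributes 1 when s = 0. *)
Definition diameter_pow s A : \bar R :=
  if A == set0 then 0 else diameter A `^ s.

Definition hausdorff_cover delta E : set ((set T)^nat) :=
  [set U | E `<=` \bigcup_k U k /\ forall k, diameter (U k) <= delta%:E].

Definition hausdorff_premeasure delta s E : \bar R :=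
  ereal_inf [set \sum_(0 <= k <oo) diameter_pow s (U k)
            | U in hausdorff_cover delta E].

Definition hausdorff_measure s E : \bar R :=
  ereal_sup [set hausdorff_premeasure delta s E
            | delta in [set delta | (0 < delta)%R]].

Definition hausdorff_dim E : \bar R :=
  ereal_inf [set s%:E | s in [set s | (0 <= s)%R /\ hausdorff_measure s E = 0]].

End Hausdorff.

Section Exponent.
Variables (R : realType) (p n : nat).
Implicit Types (xi : Qp R p) (x : 'I_n.+1 -> int).

Definition approx_error xi x : R :=
  \big[Num.max/0]_(m < n.+1 | (1 <= m)%N)
    padic_norm ((x ord0)%:~R * xi ^+ m - (x m)%:~R).

Definition approx_solvable xi (l X : R) := exists x : 'I_n.+1 -> int,
  [/\ \big[Num.max/0]_(i < n.+1) `|(x i)%:~R : R| <= X,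
      0 < approx_error xi x & approx_error xi x <= X `^ (- l - 1)].

Definition lambda_exponent xi : \bar R :=
  ereal_sup [set l%:E | l in
    [set l : R | forall X0 : R, exists2 X, X0 <= X & approx_solvable xi l X]].

End Exponent.

(* Main.v *)
Require Import Defs.
From mathcomp Require Import all_boot all_order all_algebra.
From mathcomp Require Import ring lra zify.
From mathcomp Require Import all_classical all_reals all_analysis.
Import Order.TTheory GRing.Theory Num.Theory.
Import numFieldNormedType.Exports.
Local Open Scope classical_set_scope.
Local Open Scope ring_scope.

(** Put tau = n (1 + lambda) and d = 2 / tau.

    Upper bound.  If x is a good simultaneous approximation to the powers of xi
    with an exponent larger than 1, then the integers x_0 x_(j+1) - x_1 x_j are
    too small p-adically to be nonzero, given their ordinary size; so x is a
    multiple of (a^n, a^(n-1) b, ..., b^n) for coprime integers a and b, and xi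
    lies within a constant times H^(- n (1 + l)) of b/a, where H is the larger of
    |a| and |b| and l is any exponent below lambda ([approx_solvable_rational]).
    There are about 4^m pairs (a, b) with H close to 2^m, so the obvious covers
    show that the set where lambda_n >= lambda has Hausdorff measure zero for
    every exponent s > d ([null_cover_lambda_exponent_ge]).

    Lower bound.  At the critical exponent d itself the set where
    lambda_n >= lambda is not null.  It contains, up to rational points, a Cantor
    set built from nested balls: inside a ball of radius p^(- L) with centre c one
    takes the balls of radius p^(- L') around the numbers c + p^L t/a, with t/a
    of height at most p^m, for m much larger than L and L' close to tau m.  Two
    such fractions differ modulo p^(2m) and there are at least p^(2m)/8 of them
    ([fraction_residues]), so they are as evenly spread as possible, and a mass
    distribution argument bounds the sizes of all covers from below
    ([cantor_set_balls], [cantor_set_not_null]).  The choice of m makes every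
    exponent below lambda admissible ([cantor_set_solvable]).

    Exact exponent.  The points with lambda_n > lambda form a countable union of
    sets {lambda_n >= lambda + 1/(k+1)}, each of them null for the exponent d by
    the upper bound, and the rational points are null too.  So the points with
    lambda_n = lambda cannot be null for the exponent d
    ([not_null_lambda_exponent_eq]), and both sets have dimension d. *)

Set Implicit Arguments.
Unset Strict Implicit.
Unset Printing Implicit Defensive.

(** * Null sets of the Hausdorff measures *)

Section ExtendedSeries.
Local Open Scope ereal_scope.

Lemma nneseries_le (R : realType) (u : nat -> \bar R) (c : \bar R) :
  (forall i, 0 <= u i) -> (forall k, \sum_(0 <= i < k) u i <= c) ->
  \sum_(0 <= i <oo) u i <= c.
Proof.
move=> u0 uc; apply: lime_le; last by apply: nearW => k; exact: uc.
by apply: is_cvg_nneseries => i _ _; exact: u0.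
Qed.

Lemma nneseries_geometric_le (R : realType) (c q : R) : (0 <= c)%R ->
  (0 < q < 1)%R -> \sum_(0 <= i <oo) (c * q ^+ i)%:E <= (c / (1 - q))%:E.
Proof.
move=> c0 /andP[q0 q1]; apply: nneseries_le => [i|k].
  by rewrite lee_fin mulr_ge0// exprn_ge0// ltW.
rewrite sumEFin lee_fin; apply: (@geometric_le_lim _ k c q) => //.
by rewrite ger0_norm// ltW.
Qed.

Lemma nneseries_const_le (R : realType) (u : nat -> \bar R) (c : R) (N : nat) :
  (forall i, 0 <= u i) -> (forall i, (i < N)%N -> u i <= c%:E) ->
  (forall i, (N <= i)%N -> u i = 0) ->
  \sum_(0 <= i <oo) u i <= (N%:R * c)%:E.
Proof.
move=> u0 uc uN; rewrite (nneseries_split 0 N)//.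
rewrite add0n [X in _ + X]eseries0 ?adde0; last by move=> i Ni _; exact: uN.
rewrite big_mkord (le_trans (lee_sum _ (fun i _ => uc _ (ltn_ord i))))//.
by rewrite sumEFin lee_fin sumr_const card_ord mulr_natl.
Qed.

End ExtendedSeries.

Section NullCover.
Variables (R : realType) (T : metricType R).
Implicit Types (A E : set T) (s t : R).
Local Open Scope ereal_scope.

(** For s > 0 this says that the s-dimensional Hausdorff measure of E vanishes;
    leaving out the bound on the diameters makes unions easier to handle. *)
Definition null_cover s E := forall e : R, (0 < e)%R ->
  exists U : (set T)^nat, E `<=` \bigcup_k U k /\
    \sum_(0 <= k <oo) diameter_pow s (U k) <= e%:E.

Lemma diameter_ge0 A : A !=set0 -> 0 <= diameter A.
Proof.
by move=> [x Ax]; apply: ereal_sup_ubound; exists x, x; rewrite mdistxx.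
Qed.

Lemma diameter_le A (d : R) :
  (forall x y, A x -> A y -> mdist x y <= d)%R -> diameter A <= d%:E.
Proof.
by move=> Ad; apply: ge_ereal_sup => _ [x [y [Ax Ay ->]]]; rewrite lee_fin Ad.
Qed.

Lemma mdist_le_diameter A x y : A x -> A y -> (mdist x y)%:E <= diameter A.
Proof. by move=> Ax Ay; apply: ereal_sup_ubound; exists x, y. Qed.

Lemma diameter_pow_ge0 s A : 0 <= diameter_pow s A.
Proof. by rewrite /diameter_pow; case: eqP => // _; rewrite poweR_ge0. Qed.

Lemma diameter_pow_set0 s : diameter_pow s (set0 : set T) = 0.
Proof. by rewrite /diameter_pow eqxx. Qed.

Lemma diameter_pow_le s A (d : R) : (0 <= s)%R -> (0 <= d)%R ->
  (forall x y, A x -> A y -> mdist x y <= d)%R ->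
  diameter_pow s A <= (d `^ s)%:E.
Proof.
move=> s0 d0 Ad; rewrite /diameter_pow; case: eqP => [_|/eqP/set0P An].
  by rewrite lee_fin powR_ge0.
rewrite -poweR_EFin gt0_ler_poweR ?in_itv /= ?leey ?andbT ?lee_fin//.
- exact: diameter_ge0.
- exact: diameter_le.
Qed.

Lemma mdist_pow_le_diameter_pow s A x y : (0 <= s)%R -> A x -> A y ->
  (mdist x y `^ s)%:E <= diameter_pow s A.
Proof.
move=> s0 Ax Ay; have An : A !=set0 by exists x.
rewrite /diameter_pow; case: eqP => [A0|_]; first by rewrite A0 in Ax.
rewrite -poweR_EFin gt0_ler_poweR ?in_itv /= ?leey ?andbT ?lee_fin ?mdist_ge0//.
- exact: diameter_ge0.
- exact: mdist_le_diameter.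
Qed.

Lemma nneseries_prod (a : nat -> nat -> \bar R) (f : nat -> nat * nat) :
  bijective f -> (forall i j, 0 <= a i j) ->
  \sum_(0 <= k <oo) a (f k).1 (f k).2 =
  \sum_(0 <= i <oo) \sum_(0 <= j <oo) a i j.
Proof.
move=> [g fK gK] a0.
transitivity (\esum_(x in [set: nat * nat]) a x.1 x.2).
  rewrite (reindex_esum [set: nat] _ f) ?nneseries_esumT//.
  split=> // [x y _ _ /(can_inj fK)//|x _]; by exists (g x).
rewrite nneseries_esumT; last by move=> i; exact: nneseries_ge0.
transitivity (\esum_(i in [set: nat]) \esum_(j in [set: nat]) a i j).
  rewrite esum_esum//; congr (\esum_(x in _) _).
  by apply/seteqP; split.
by apply: eq_esum => i _; rewrite nneseries_esumT.
Qed.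

(** Re-enumerate the pairs of indices: a double series of nonnegative terms can
    be summed in any order. *)
Lemma merge_cover (U : nat -> nat -> set T) s E (e : \bar R) :
  E `<=` \bigcup_i \bigcup_j U i j ->
  \sum_(0 <= i <oo) \sum_(0 <= j <oo) diameter_pow s (U i j) <= e ->
  exists V : (set T)^nat, E `<=` \bigcup_k V k /\
    \sum_(0 <= k <oo) diameter_pow s (V k) <= e.
Proof.
move=> EU Ue; have /card_esym/ppcard_eqP[f] := card_nat2.
exists (fun k => U (f k).1 (f k).2); split=> [x /EU[i _ [j _ Uij]]|].
  by exists (f^-1%FUN (i, j)) => //=; rewrite invK ?inE.
have fbij : bijective f.
  by exists (f^-1%FUN) => x; rewrite ?funK ?invK ?inE.
have := nneseries_prod fbij (fun i j => diameter_pow_ge0 s (U i j)).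
by move=> ->.
Qed.

Lemma null_cover_subset s A E : A `<=` E -> null_cover s E -> null_cover s A.
Proof.
by move=> AE nE e /nE[U [EU Ue]]; exists U; split=> //; exact: subset_trans EU.
Qed.

Lemma null_cover_bigcup s (E : nat -> set T) :
  (forall i, null_cover s (E i)) -> null_cover s (\bigcup_i E i).
Proof.
move=> nE e e0.
have /choice[U HU] : forall i, exists U : (set T)^nat, E i `<=` \bigcup_k U k /\
    \sum_(0 <= k <oo) diameter_pow s (U k) <= (e / (2 ^ i.+1)%:R)%:E.
  by move=> i; apply: nE; rewrite divr_gt0 // ltr0n expn_gt0.
apply: (@merge_cover U).
  by move=> x [i _ /(HU i).1 Ux]; exists i.
apply: le_trans (epsilon_trick0 xpredT (ltW e0)).
apply: lee_nneseries => [i _ _|i _]; last exact: (HU i).2.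
by apply: nneseries_ge0 => k _ _; exact: diameter_pow_ge0.
Qed.

Lemma null_cover1 s x : (0 < s)%R -> null_cover s [set x].
Proof.
move=> s0 e e0; exists (fun k => if k is 0%N then [set x] else set0).
split=> [y ->|]; first by exists 0%N.
rewrite eseries0 ?lee_fin ?ltW// => -[|i] _ _; last exact: diameter_pow_set0.
apply/eqP; rewrite eq_le diameter_pow_ge0 andbT.
rewrite (le_trans (diameter_pow_le (d := 0) (ltW s0) _ _))//.
- by move=> _ _ -> ->; rewrite mdistxx.
- by rewrite powR0 ?gt_eqF.
Qed.

(** For a positive exponent a small sum forces small diameters, so that the
    bound on the diameters in the definition of the measure comes for free. *)
Lemma null_cover_measure0 s E : (0 < s)%R -> null_cover s E ->
  hausdorff_measure s E = 0.
Proof.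
move=> s0 nE; apply/eqP; rewrite eq_le; apply/andP; split.
  apply: ge_ereal_sup => _ [d /= d0 <-].
  apply/lee_addgt0Pr => e e0; rewrite add0e.
  set e' := Num.min e (d `^ s)%R.
  have e'0 : (0 < e')%R by rewrite lt_min e0 powR_gt0.
  have [U [EU Ue]] := nE _ e'0.
  apply: (@le_trans _ _ e'%:E); last by rewrite lee_fin ge_min lexx.
  apply: (le_trans _ Ue); apply: ereal_inf_lbound; exists U => //; split=> // k.
  have [->|/set0P Uk] := eqVneq (U k) set0.
    by apply: ge_ereal_sup => _ [x [y [[]]]].
  have Ukd : diameter (U k) `^ s <= (d `^ s)%:E.
    apply: (@le_trans _ _ e'%:E); last by rewrite lee_fin ge_min lexx orbT.
    apply: (le_trans _ Ue).
    rewrite (_ : _ `^ s = diameter_pow s (U k)); last first.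
      by rewrite /diameter_pow; case: eqP => // U0; case: Uk => x; rewrite U0.
    apply: (@le_trans _ _ (\sum_(0 <= i < k.+1) diameter_pow s (U i))).
      by rewrite big_nat_recr //= leeDr // sume_ge0 // => i _; exact: diameter_pow_ge0.
    by apply: nneseries_lim_ge => i _ _; exact: diameter_pow_ge0.
  have := diameter_ge0 Uk; move: Ukd; case: (diameter (U k)) => [r| |] //=.
    rewrite !lee_fin => rd r0; rewrite leNgt; apply/negP => dr.
    have := gt0_ltr_powR s0 (ltW d0) r0 dr; rewrite ltNge rd//.
  by rewrite /poweR gt_eqF.
apply: (@le_trans _ _ (hausdorff_premeasure 1 s E)).
  apply: le_ereal_inf_tmp => _ [U _ <-].
  by apply: nneseries_ge0 => i _ _; exact: diameter_pow_ge0.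
by apply: ereal_sup_ubound; exists 1%R => //=.
Qed.

(** In a cover by sets of diameter at most 1, raising the exponent from s to t
    only decreases the terms.  This includes s = 0, where nonempty sets count
    for 1. *)
Lemma measure0_null_cover s t E : (0 <= s <= t)%R ->
  hausdorff_measure s E = 0 -> null_cover t E.
Proof.
move=> /andP[s0 st] sE e e0.
have : hausdorff_premeasure 1 s E <= 0.
  by rewrite -sE; apply: ereal_sup_ubound; exists 1%R => //=.
have e0' : 0 < e%:E by rewrite lte_fin.
move=> /le_lt_trans /(_ e0') /ereal_inf_lt [_ [U [EU U1] <-] Ue].
exists U; split=> //; apply: le_trans (ltW Ue).
apply: lee_nneseries => [k _ _|k _]; first exact: diameter_pow_ge0.
rewrite /diameter_pow; case: eqP => // /eqP/set0P /diameter_ge0.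
have := U1 k; case: (diameter (U k)) => [r| |] //.
rewrite !lee_fin => r1 r0.
have [->|r0'] := eqVneq r 0%R.
  have [t0|t0] := eqVneq t 0%R; last by rewrite powR0// powR_ge0.
  by have -> : s = t by apply/eqP; rewrite eq_le st t0 s0.
by apply: ger_powR => //; rewrite lt_neqAle eq_sym r0' r0.
Qed.

End NullCover.

Lemma null_coverU (R : realType) (T : metricType R) (s : R) (A B : set T) :
  null_cover s A -> null_cover s B -> null_cover s (A `|` B).
Proof.
move=> nA nB; apply: (@null_cover_subset _ _ _ _ (\bigcup_i (if i is 0%N then A else B))).
  by move=> x [Ax|Bx]; [exists 0%N|exists 1%N].
by apply: null_cover_bigcup => -[|i].
Qed.

(** An exponent s < d for which the measure vanishes would make A null for d as
    well, so it is enough to look at d itself. *)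
Lemma hausdorff_dim_eq (R : realType) (T : metricType R) (d : R) (A : set T) :
  0 < d -> (forall s, d < s -> null_cover s A) -> ~ null_cover d A ->
  hausdorff_dim A = d%:E.
Proof.
move=> d0 nA dA; apply/eqP; rewrite eq_le; apply/andP; split.
  apply/lee_addgt0Pr => e e0; apply: ereal_inf_lbound.
  have de : d < d + e by rewrite ltrDl.
  exists (d + e) => //; split; first by rewrite ltW// (lt_trans d0).
  by apply: null_cover_measure0 (nA _ de); rewrite (lt_trans d0).
apply: le_ereal_inf_tmp => _ [s [s0 sA] <-]; rewrite lee_fin leNgt; apply/negP => sd.
by apply: dA; apply: measure0_null_cover sA; rewrite s0 ltW.
Qed.

(** * The p-adic norm *)

Section PadicNorm.
Variables (R : realType) (p : nat).
Hypothesis p_prime : prime p.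
Local Notation K := (Qp R p).
Local Notation norm := (@padic_norm R p).
Implicit Types (x y : K) (z : int).

Let p_gt1 : 1 < p%:R :> R. Proof. by rewrite ltr1n prime_gt1. Qed.
Let p_gt0 : 0 < p%:R :> R. Proof. exact: lt_trans ltr01 p_gt1. Qed.

Lemma padic_norm1 : norm 1 = 1.
Proof. by rewrite -[1]/(1%:~R) padic_norm_intr padic_abs1. Qed.

Lemma padic_normX x k : norm (x ^+ k) = norm x ^+ k.
Proof.
by elim: k => [|k IH]; rewrite ?expr0 ?padic_norm1// !exprS padic_normM IH.
Qed.

Lemma padic_norm_gt0 x : (0 < norm x) = (x != 0).
Proof. by rewrite lt_def padic_norm_ge0 andbT padic_norm_eq0. Qed.

Lemma padic_normB x y : norm (x - y) = norm (y - x).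
Proof. by rewrite -opprB padic_normN. Qed.

Lemma padic_normD_le x y (r : R) : norm x <= r -> norm y <= r -> norm (x + y) <= r.
Proof. by move=> xr yr; rewrite (le_trans (padic_norm_maxD _ _))// ge_max xr. Qed.

Lemma padic_normB_le x y (r : R) : norm x <= r -> norm y <= r -> norm (x - y) <= r.
Proof. by move=> xr yr; rewrite padic_normD_le// padic_normN. Qed.

Lemma padic_dist_le_trans x y w (r : R) :
  norm (x - y) <= r -> norm (y - w) <= r -> norm (x - w) <= r.
Proof. by move=> xy yw; rewrite -(subrK y x) -addrA padic_normD_le. Qed.

Lemma padic_norm_dominant x y : norm (x - y) < norm y -> norm x = norm y.
Proof.
move=> xy; apply/eqP; rewrite eq_le; apply/andP; split.
  by rewrite -(subrK y x) padic_normD_le// ltW.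
rewrite leNgt; apply/negP => xy'; suff : norm y < norm y by rewrite ltxx.
rewrite -{1}(subrK x y) (le_lt_trans (padic_norm_maxD _ _))// gt_max xy' andbT.
by rewrite padic_normB.
Qed.

Lemma padic_intr_eq0 z : (z%:~R == 0 :> K) = (z == 0).
Proof. by rewrite -padic_norm_eq0 padic_norm_intr padic_abs_eq0 intr_eq0. Qed.

Lemma padic_norm_intE z : z != 0 ->
  norm z%:~R = (p%:R ^+ logn p `|z|%N)^-1.
Proof.
move=> z0; rewrite padic_norm_intr /padic_abs intr_eq0 (negbTE z0).
by rewrite numq_int denq_int logn1 expr0 div1r.
Qed.

Lemma padic_norm_int_le1 z : norm z%:~R <= 1.
Proof.
have [->|z0] := eqVneq z 0; first by rewrite padic_norm0.
by rewrite padic_norm_intE// invf_le1 ?exprn_gt0// exprn_ege1// ltW.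
Qed.

(** The product formula: an integer cannot be p-adically smaller than the
    inverse of its ordinary absolute value. *)
Lemma padic_norm_int_ge z : z != 0 -> (`|z|%:~R)^-1 <= norm z%:~R.
Proof.
move=> z0; rewrite padic_norm_intE// lef_pV2 ?posrE ?exprn_gt0//.
  rewrite -natrX -abszE -pmulrn ler_nat dvdn_leq ?absz_gt0//.
  exact: pfactor_dvdnn.
by rewrite ltr0z normr_gt0.
Qed.

Lemma padic_norm_int_dvd z k :
  (norm z%:~R <= (p%:R ^+ k)^-1) = (p ^ k %| `|z|)%N.
Proof.
have [->|z0] := eqVneq z 0.
  by rewrite padic_norm0 absz0 dvdn0 invr_ge0 ltW// exprn_gt0.
rewrite padic_norm_intE// lef_pV2 ?posrE ?exprn_gt0//.
by rewrite ler_eXn2l// pfactor_dvdn// absz_gt0.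
Qed.

Lemma padic_norm_int_coprime z : ~~ (p %| `|z|)%N -> norm z%:~R = 1.
Proof.
move=> pz; rewrite padic_norm_intE; last by apply: contraNneq pz => ->.
by rewrite lognE p_prime absz_gt0 (negbTE pz) andbF expr0 invr1.
Qed.

Lemma padic_norm_pX k : norm (p%:R ^+ k) = (p%:R ^+ k)^-1.
Proof.
rewrite -natrX [(p ^ k)%:R](_ : _ = (p ^ k)%:Z%:~R)// padic_norm_intE.
  by rewrite absz_nat pfactorK.
by rewrite eqz_nat expn_eq0 negb_and -lt0n prime_gt0.
Qed.

Lemma padic_norm_dec (i j : nat) : (i <= j)%N -> (p%:R ^+ j)^-1 <= (p%:R ^+ i)^-1 :> R.
Proof. by move=> ij; rewrite lef_pV2 ?posrE ?exprn_gt0// ler_eXn2l. Qed.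

Lemma padic_norm_subX_le x y i : norm x <= 1 -> norm y <= 1 ->
  norm (x ^+ i - y ^+ i) <= norm (x - y).
Proof.
move=> x1 y1; elim: i => [|i IH].
  by rewrite !expr0 subrr padic_norm0 padic_norm_ge0.
have -> : x ^+ i.+1 - y ^+ i.+1 = x * (x ^+ i - y ^+ i) + (x - y) * y ^+ i.
  by rewrite !exprS; ring.
apply: padic_normD_le; rewrite padic_normM.
  by apply: le_trans IH; rewrite ler_piMl ?padic_norm_ge0.
by rewrite ler_piMr ?padic_norm_ge0// padic_normX// exprn_ile1// padic_norm_ge0.
Qed.

(** Completeness for nested balls: by the ultrametric inequality the whole tail
    of the sequence stays in each of them, and they are closed. *)
Lemma padic_limit (c : nat -> K) (r : nat -> nat) :
  (forall k, (k <= r k)%N) -> (forall k, (r k <= r k.+1)%N) ->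
  (forall k, norm (c k.+1 - c k) <= (p%:R ^+ r k)^-1) ->
  exists x, forall k, norm (x - c k) <= (p%:R ^+ r k)^-1.
Proof.
move=> rk rS cS.
have cD k j : norm (c (k + j)%N - c k) <= (p%:R ^+ r k)^-1.
  elim: j => [|j IH]; first by rewrite addn0 subrr padic_norm0 invr_ge0 ltW// exprn_gt0.
  rewrite addnS (padic_dist_le_trans _ IH)//; apply: le_trans (cS _) _.
  apply: padic_norm_dec; elim: {IH} j => [|j IH]; first by rewrite addn0.
  by rewrite addnS (leq_trans IH).
have : cvgn c.
  apply: cauchy_cvg; apply/cauchy_exP => e e0.
  have [N _ Ne] : \forall N \near \oo, (p%:R^-1) ^+ N < e.
    have h : `|p%:R^-1 : R| < 1 by rewrite ger0_norm ?invr_ge0 ?ltW// invf_lt1.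
    apply: (cvgr_lt 0) => //; have := cvg_geometric (1 : R) h.
    by apply: cvg_trans; apply: near_eq_cvg; near=> k; rewrite /= mul1r.
  have {Ne} := Ne N (leqnn N); rewrite exprVn => Ne.
  exists (c N), N => // k /= /subnKC <-; rewrite ballEmdist /=.
  rewrite padic_mdistE padic_normB (le_lt_trans _ Ne)// (le_trans (cD _ _))//.
  exact: padic_norm_dec.
move=> /cvg_ex[x cx]; exists x => k.
have e0 : 0 < (p%:R ^+ r k)^-1 :> R by rewrite invr_gt0 exprn_gt0.
have [N _ Nx] := (metricType_numDomainType.fcvgrPdist_lt x).1 cx _ e0.
have := Nx (maxn N k) (leq_maxl _ _); rewrite /= padic_mdistE => xck.
rewrite (padic_dist_le_trans (ltW xck))//.
by rewrite -(subnKC (leq_maxr N k)) cD.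
Unshelve. all: by end_near. Qed.

End PadicNorm.

(** * Good approximations come from rational numbers *)

(** The ratio is b/a in lowest terms, so that a^n y_n = b^n y_0 with a^n and b^n
    coprime, and therefore a^n divides y_0. *)
Lemma integer_geometric_progression (y : nat -> int) (n : nat) : y 0%N != 0 ->
  (forall j, (j < n)%N -> y 0%N * y j.+1 = y 1%N * y j) ->
  exists a b g : int, [/\ a != 0, g != 0 & coprimez a b] /\
    [/\ y 0%N = g * a ^+ n, y n = g * b ^+ n & a * y 1%N = b * y 0%N].
Proof.
move=> y0 yS; set d := gcdz (y 0%N) (y 1%N).
have d0 : d != 0 by rewrite gcdz_eq0 (negbTE y0).
have /dvdzP[a ya] : (d %| y 0%N)%Z by exact: dvdz_gcdl.
have /dvdzP[b yb] : (d %| y 1%N)%Z by exact: dvdz_gcdr.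
have a0 : a != 0 by apply: contraNneq y0; rewrite ya => ->; rewrite mul0r.
have cab : coprimez a b.
  have dE : d = `|d| by rewrite ger0_norm.
  rewrite /coprimez; apply/eqP/(mulIf d0); rewrite mul1r [in LHS]dE.
  by rewrite mulz_gcdl -ya -yb.
have yab j : (j < n)%N -> a * y j.+1 = b * y j.
  move=> jn; apply: (mulIf d0); have := yS _ jn; rewrite ya yb.
  by rewrite -!mulrA ![_ * d]mulrC.
have yj j : (j <= n)%N -> a ^+ j * y j = b ^+ j * y 0%N.
  elim: j => [|j IH] jn; first by rewrite !expr0.
  by rewrite !exprS -mulrA mulrCA (yab _ jn) mulrCA IH ?(ltnW jn)// mulrA.
have /dvdzP[g yg] : (a ^+ n %| y 0%N)%Z.
  rewrite -(@Gauss_dvdzr _ (b ^+ n)) -?yj//; last first.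
    by rewrite coprimezXl// coprimezXr.
  by rewrite dvdz_mulr.
exists a, b, g; split; split=> //.
- by apply: contraNneq y0; rewrite yg => ->; rewrite mul0r.
- have an0 : a ^+ n != 0 by rewrite expf_neq0.
  by apply: (mulfI an0); rewrite yj// yg; ring.
- by rewrite ya yb; ring.
Qed.

Section Approximations.
Variables (R : realType) (p n : nat).
Hypothesis p_prime : prime p.
Local Notation K := (Qp R p).
Local Notation norm := (@padic_norm R p).
Implicit Types (xi : K) (x : 'I_n.+1 -> int).

Lemma le_approx_error xi x (j : nat) : (j <= n)%N ->
  norm ((x ord0)%:~R * xi ^+ j - (x (inord j))%:~R) <= approx_error xi x.
Proof.
case: j => [|j] jn.
  rewrite expr0 mulr1 (_ : inord 0 = ord0) ?subrr ?padic_norm0; last first.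
    by apply: val_inj; rewrite /= inordK.
  exact: bigmax_ge_id.
rewrite -[X in xi ^+ X](@inordK n)//.
by apply: (le_bigmax_cond _ (fun m : 'I_n.+1 => norm ((x ord0)%:~R * xi ^+ m - (x m)%:~R)));
  rewrite inordK.
Qed.

Lemma approx_error_le xi x (r : R) : 0 <= r ->
  (forall j, (j <= n)%N -> norm ((x ord0)%:~R * xi ^+ j - (x (inord j))%:~R) <= r) ->
  approx_error xi x <= r.
Proof.
move=> r0 xr; apply: bigmax_le => // i _; have := xr i; rewrite inord_val.
by apply; rewrite -ltnS.
Qed.

Lemma approx_error_gt0 xi x : 0 < approx_error xi x ->
  exists2 j, (j <= n)%N & (x ord0)%:~R * xi ^+ j != (x (inord j))%:~R.
Proof.
move=> e0; apply/not_exists2P => H; move: e0; rewrite ltNge => /negP; apply.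
apply: approx_error_le => // j jn.
have [|/negP/negPn/eqP ->] := H j; first by move=> /(_ jn).
by rewrite subrr padic_norm0.
Qed.

(** A simultaneous approximation of exponent larger than 1 is, up to a common
    factor, the tuple of the a^(n-i) b^i of a single rational number b/a: the
    two-by-two minors x_0 x_(j+1) - x_1 x_j are integers of absolute value at
    most 2 X^2 whose p-adic norm is at most M X^(-l-1), so they vanish.  If g is
    the common factor, the error divided by the norm of x_0 = g a^n bounds the
    distance between xi and b/a; the norm of g is at least 1/|g|, that of a at
    least 1/M. *)
Lemma approx_solvable_rational xi (l X M : R) : (1 <= n)%N -> 1 < l -> 1 < X ->
  1 <= M -> norm xi <= M -> 2 * M * X `^ (1 - l) < 1 ->
  approx_solvable n xi l X ->
  exists a b : int, [/\ a != 0, b%:~R / a%:~R != xi,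
    `|a|%:~R ^+ n <= X, `|b|%:~R ^+ n <= X &
    norm (xi - b%:~R / a%:~R) <=
      M ^+ n * X `^ (- l) / Num.max `|a|%:~R `|b|%:~R ^+ n].
Proof.
move=> n1 l1 X1 M1 xiM XM [x [xX e0 eX]].
have X0 : 0 < X by rewrite (lt_trans _ X1).
set err := approx_error xi x in e0 eX.
pose y j := x (inord j).
have y0E : y 0%N = x ord0 by congr x; apply: val_inj; rewrite /= inordK.
have yX j : `|y j|%:~R <= X :> R.
  rewrite intr_norm (le_trans _ xX)//.
  exact: (le_bigmax_cond _ (fun i => `|(x i)%:~R : R|)).
have yE j : (j <= n)%N -> norm ((y 0%N)%:~R * xi ^+ j - (y j)%:~R) <= err.
  by rewrite y0E => jn; exact: le_approx_error.
set q := X `^ (- l).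
have q0 : 0 < q by rewrite powR_gt0.
have qE : X `^ (- l - 1) = q / X.
  by rewrite powRB ?(gt_eqF X0) ?implybT// powRr1 // ltW.
have {}XM : 2 * M * X * q < 1.
  by move: XM; rewrite powRD ?(gt_eqF X0) ?implybT// powRr1 ?ltW// !mulrA.
have M0 : 0 < M by rewrite (lt_le_trans ltr01).
have q1 : q < 1.
  apply: le_lt_trans XM; rewrite ler_peMl ?(ltW q0)//.
  by rewrite !mulr_ege1 ?ler1n// ltW.
have {}eX : err <= q / X by rewrite -qE.
have normz (z : int) (Z : R) : z != 0 -> `|z|%:~R <= Z -> Z^-1 <= norm z%:~R.
  move=> z0 zZ; apply: le_trans (padic_norm_int_ge _ p_prime z0).
  have z0' : 0 < `|z|%:~R :> R by rewrite ltr0z normr_gt0.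
  by rewrite lef_pV2 ?posrE// (lt_le_trans z0').
(* If x_0 = 0, some nonzero x_j has norm less than 1 / X. *)
have y00 : y 0%N != 0.
  apply/eqP => y00; have [j jn] := approx_error_gt0 e0.
  rewrite -y0E -/(y j) y00 mulr0z mul0r eq_sym padic_intr_eq0 => yj0.
  have := yE _ jn; rewrite y00 mulr0z mul0r sub0r padic_normN => yje.
  have := le_trans (le_trans (normz _ _ yj0 (yX j)) yje) eX.
  by rewrite ler_pdivlMr// mulVf ?gt_eqF// leNgt q1.
have err0 : 0 <= err by rewrite ltW.
have minors j : (j < n)%N -> y 0%N * y j.+1 = y 1%N * y j.
  move=> jn; apply/eqP; rewrite -subr_eq0; apply/negPn/negP => z0.
  set z := (X in X != 0) in z0.
  have zX : `|z|%:~R <= 2 * X ^+ 2.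
    rewrite /z intr_norm rmorphB/= !rmorphM/= (le_trans (ler_normB _ _))//.
    rewrite !normrM mulr2n mulrDl mul1r expr2 -!intr_norm.
    by apply: lerD; apply: ler_pM; rewrite ?ler0z.
  have := normz _ _ z0 zX; apply/negP; rewrite -ltNge.
  have zE : z%:~R = (y 0%N)%:~R * xi * ((y 0%N)%:~R * xi ^+ j - (y j)%:~R) +
      ((y 0%N)%:~R * xi ^+ 1 - (y 1%N)%:~R) * (y j)%:~R -
      (y 0%N)%:~R * ((y 0%N)%:~R * xi ^+ j.+1 - (y j.+1)%:~R) :> K.
    by rewrite /z rmorphB/= !rmorphM/= expr1 exprS; ring.
  have zM : norm z%:~R <= M * err.
    have eMe : err <= M * err by rewrite ler_peMl.
    rewrite zE; apply: padic_normB_le; first apply: padic_normD_le.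
    - rewrite !padic_normM ler_pM ?padic_norm_ge0 ?mulr_ge0 ?padic_norm_ge0 ?yE 1?ltnW//.
      by rewrite -[leRHS]mul1r ler_pM ?padic_norm_ge0 ?padic_norm_int_le1.
    - rewrite padic_normM (le_trans _ eMe)// (le_trans _ (yE _ n1))//.
      by rewrite ler_piMr ?padic_norm_ge0 ?padic_norm_int_le1.
    - rewrite padic_normM (le_trans _ eMe)// (le_trans _ (yE _ jn))//.
      by rewrite ler_piMl ?padic_norm_ge0 ?padic_norm_int_le1.
  rewrite (le_lt_trans zM)// (le_lt_trans (ler_wpM2l (ltW M0) eX))//.
  rewrite -[ltRHS]mul1r ltr_pdivlMr ?mulr_gt0 ?exprn_gt0//.
  rewrite [X in X < _](_ : _ = 2 * M * X * q)//.
  by field; rewrite gt_eqF.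
have [a [b [g [[a0 g0 ab] [y0a ynb aby]]]]] := integer_geometric_progression y00 minors.
have aK0 : a%:~R != 0 :> K by rewrite padic_intr_eq0.
have y0K0 : (y 0%N)%:~R != 0 :> K by rewrite padic_intr_eq0.
have abyK : a%:~R * (y 1%N)%:~R = b%:~R * (y 0%N)%:~R :> K by rewrite -!rmorphM/= aby.
have xib : b%:~R / a%:~R = (y 1%N)%:~R / (y 0%N)%:~R :> K.
  by apply/eqP; rewrite eqr_div// -abyK mulrC.
have e1E : (y 0%N)%:~R * xi ^+ 1 - (y 1%N)%:~R = (y 0%N)%:~R * (xi - b%:~R / a%:~R).
  by rewrite xib expr1 mulrBr mulrCA divff// mulr1.
have aX : `|g|%:~R * `|a|%:~R ^+ n <= X :> R.
  by rewrite -rmorphXn -rmorphM/= -normrX -normrM -y0a.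
have bX : `|g|%:~R * `|b|%:~R ^+ n <= X :> R.
  by rewrite -rmorphXn -rmorphM/= -normrX -normrM -ynb.
have g1 : 1 <= `|g|%:~R :> R.
  by rewrite -[1]/(1%:~R) ler_int -gtz0_ge1 normr_gt0.
have a1 : 1 <= `|a|%:~R :> R.
  by rewrite -[1]/(1%:~R) ler_int -gtz0_ge1 normr_gt0.
(* If p divides a, then it does not divide b.  The error is less than 1 / X,
   hence than the norm of x_1, so a xi has the same norm as b, which is 1. *)
have Mge : M^-1 <= norm a%:~R.
  have [pa|pa] := boolP (p %| `|a|)%N; last first.
    by rewrite padic_norm_int_coprime// invf_le1.
  have pb : ~~ (p %| `|b|)%N.
    apply/negP => pb; have : (p %| gcdn `|a| `|b|)%N by rewrite dvdn_gcd pa.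
    move: ab; rewrite coprimezE => /eqP ->; rewrite dvdn1 => /eqP p1.
    by move: p_prime; rewrite p1.
  have b0 : b != 0 by apply: contraNneq pb => ->.
  have nb := padic_norm_int_coprime R p_prime pb.
  have y10 : y 1%N != 0.
    have : b * y 0%N != 0 by rewrite mulf_neq0.
    by rewrite -aby mulf_eq0 negb_or => /andP[].
  have ny1 := normz _ _ y10 (yX 1%N).
  have : norm (a%:~R * xi - b%:~R) < norm b%:~R.
    rewrite nb -(ltr_pM2r (_ : 0 < norm (y 0%N)%:~R)) ?padic_norm_gt0//.
    have -> : norm (a%:~R * xi - b%:~R) * norm (y 0%N)%:~R =
      norm a%:~R * norm ((y 0%N)%:~R * xi ^+ 1 - (y 1%N)%:~R).
      by rewrite -!padic_normM mulrBl -abyK expr1; congr norm; ring.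
    have -> : 1 * norm (y 0%N)%:~R = norm a%:~R * norm (y 1%N)%:~R.
      by rewrite -nb -!padic_normM abyK.
    rewrite ltr_pM2l ?padic_norm_gt0// (le_lt_trans (yE _ n1))//.
    rewrite (le_lt_trans eX)// (lt_le_trans _ ny1)//.
    by rewrite ltr_pdivrMr// mulVf ?gt_eqF.
  move=> /(padic_norm_dominant); rewrite nb padic_normM => axi.
  rewrite -[leLHS]mul1r -axi ler_pdivrMr//.
  by rewrite ler_wpM2l ?padic_norm_ge0.
exists a, b; split=> //.
- apply/negP => /eqP xiE; have [j jn] := approx_error_gt0 e0.
  rewrite -y0E -/(y j) => /eqP; apply.
  elim: j jn => [|j IH] jn; first by rewrite expr0 mulr1.
  rewrite exprS mulrCA IH ?(ltnW jn)// -xiE xib.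
  apply: (mulfI y0K0); rewrite mulrA [X in X * _]mulrC divfK//.
  by rewrite -!rmorphM/= minors.
- by apply: le_trans aX; rewrite ler_peMl// exprn_ge0// ler0z.
- by apply: le_trans bX; rewrite ler_peMl// exprn_ge0// ler0z.
set H := Num.max _ _.
have H1 : 1 <= H by rewrite le_max a1.
have H0 : 0 < H ^+ n by rewrite exprn_gt0// (lt_le_trans ltr01).
have gH : `|g|%:~R * H ^+ n <= X by rewrite /H maxEle; case: ifP.
have ny0 : `|g|%:~R^-1 * (M ^+ n)^-1 <= norm (y 0%N)%:~R.
  rewrite y0a rmorphM rmorphXn/= padic_normM padic_normX ler_pM//.
  - by rewrite invr_ge0 exprn_ge0// ltW.
  - exact: padic_norm_int_ge.
  - by rewrite -exprVn lerXn2r// nnegrE ?padic_norm_ge0// invr_ge0 ltW.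
have := le_trans (yE _ n1) eX; rewrite e1E padic_normM.
move=> h; have {h} := le_trans (ler_wpM2r (padic_norm_ge0 _) ny0) h.
set D := norm _ => h.
have g0' : 0 < `|g|%:~R :> R by rewrite (lt_le_trans ltr01).
have Mn0 : 0 < M ^+ n by rewrite exprn_gt0.
rewrite ler_pdivlMr//.
have : D <= `|g|%:~R * M ^+ n * (q / X).
  rewrite -ler_pdivrMl ?mulr_gt0//; apply: le_trans h.
  by rewrite invfM.
move=> /(ler_wpM2r (ltW H0)) /le_trans; apply.
rewrite (_ : _ * H ^+ n = M ^+ n * q * ((`|g|%:~R * H ^+ n) / X)); last by ring.
by rewrite ler_piMr ?(ltW (mulr_gt0 Mn0 q0))// ler_pdivrMr// mul1r.
Qed.

End Approximations.

(** * The upper bound for the dimension *)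

(** The square |a|, |b| <= h, numbered by rows of length 2h + 1. *)
Definition int_pair (h k : nat) : int * int :=
  ((k %/ (2 * h).+1)%N%:Z - h%:Z, (k %% (2 * h).+1)%N%:Z - h%:Z).

Lemma int_pair_surj (h : nat) (a b : int) : (`|a| <= h)%N -> (`|b| <= h)%N ->
  exists2 k, (k < (2 * h).+1 ^ 2)%N & int_pair h k = (a, b).
Proof.
move=> ah bh; set i := absz (a + h%:Z); set j := absz (b + h%:Z).
have iE : i%:Z = a + h%:Z by rewrite /i; lia.
have jE : j%:Z = b + h%:Z by rewrite /j; lia.
have ih : (i < (2 * h).+1)%N by lia.
have jh : (j < (2 * h).+1)%N by lia.
exists (i * (2 * h).+1 + j)%N; first by nia.
rewrite /int_pair divnMDl// (divn_small jh) addn0 modnMDl (modn_small jh).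
by rewrite iE jE !addrK.
Qed.

Lemma finite_positive_lower_bound (R : realType) (f : nat -> R) N :
  exists2 r, 0 < r & forall k, (k < N)%N -> 0 < f k -> r <= f k.
Proof.
elim: N => [|N [r r0 rf]]; first by exists 1.
have [fN|fN] := ltP 0 (f N).
  exists (Num.min r (f N)) => [|k]; first by rewrite lt_min r0.
  rewrite ltnS leq_eqVlt ge_min => /predU1P[->|kN fk]; first by rewrite lexx orbT.
  by rewrite rf.
exists r => // k; rewrite ltnS leq_eqVlt => /predU1P[->|kN fk]; last exact: rf.
by rewrite ltNge fN.
Qed.

Lemma powR_neg_small (R : realType) (t c e : R) : t < 0 -> 0 < c -> 0 < e ->
  exists X0, forall X, X0 <= X -> c * X `^ t < e.
Proof.
move=> t0 c0 e0; set u := - t; have u0 : 0 < u by rewrite oppr_gt0.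
have ce0 : 0 < c / e by rewrite divr_gt0.
exists ((c / e) `^ u^-1 + 1) => X hX.
have hX' : (c / e) `^ u^-1 < X by rewrite (lt_le_trans _ hX)// ltrDl.
have X0 : 0 < X by rewrite (le_lt_trans _ hX')// powR_ge0.
have := gt0_ltr_powR u0 (_ : _ \in Num.nneg) (_ : _ \in Num.nneg) hX'.
rewrite !nnegrE powR_ge0 (ltW X0) => /(_ isT isT).
rewrite -powRrM mulVf ?gt_eqF// powRr1 ?(ltW ce0)//.
move=> h; have -> : t = - u by rewrite opprK.
by rewrite powRN ltr_pdivrMr ?powR_gt0// mulrC -ltr_pdivrMr.
Qed.

Lemma shell_card k : ((2 * 2 ^ k.+1).+1 ^ 2 <= 25 * 4 ^ k)%N.
Proof.
have -> : (25 * 4 ^ k = (5 * 2 ^ k) ^ 2)%N.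
  by rewrite expnMn -expnM (mulnC k) expnM.
rewrite leq_exp2r// expnS; have := expn_gt0 2 k; lia.
Qed.

Section UpperBound.
Variables (R : realType) (p n : nat).
Hypotheses (p_prime : prime p) (n_gt0 : (0 < n)%N).
Local Notation K := (Qp R p).
Local Notation norm := (@padic_norm R p).
Implicit Types (xi : K) (l M X : R).

Lemma approx_solvable_weaken xi l l' X : 1 <= X -> l' <= l ->
  approx_solvable n xi l X -> approx_solvable n xi l' X.
Proof.
move=> X1 ll [x [xX x0 xe]]; exists x; split=> //; apply: le_trans xe _.
by apply: ler_powR => //; rewrite lerB// lerN2.
Qed.

Lemma lambda_exponent_solvable xi l lam : l < lam ->
  (lam%:E <= lambda_exponent n xi)%E ->
  forall X0, exists2 X, X0 <= X & approx_solvable n xi l X.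
Proof.
move=> llam lamxi X0.
have : (l%:E < lambda_exponent n xi)%E by rewrite (lt_le_trans _ lamxi)// lte_fin.
move=> /ereal_sup_gt[_ [l' /= solv <-]]; rewrite lte_fin => ll'.
have [X XX0 solvX] := solv (Num.max 1 X0).
move: XX0; rewrite ge_max => /andP[X1 XX0]; exists X => //.
exact: approx_solvable_weaken (ltW ll') solvX.
Qed.

(** The bound M^n H^(- n (1 + l)) at H = 2^m, where M bounds the norm of the
    point to be approximated. *)
Definition shell_radius l M (m : nat) : R :=
  M ^+ n * (2 ^+ m) `^ (- (n%:R * (1 + l))).

(** Here m is chosen with 2^m <= max(|a|, |b|) < 2^(m+1).  It can be made large,
    because the finitely many b/a of bounded height other than xi keep a positive
    distance from xi, whereas the error tends to 0 when X grows. *)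
Lemma lambda_exponent_near_rational xi l lam M : 1 < l -> l < lam ->
  1 <= M -> norm xi <= M -> (lam%:E <= lambda_exponent n xi)%E ->
  forall m0 : nat, exists m, exists a b : int,
    [/\ (m0 <= m)%N, (`|a| <= 2 ^ m.+1)%N, (`|b| <= 2 ^ m.+1)%N &
        norm (xi - b%:~R / a%:~R) <= shell_radius l M m].
Proof.
move=> l1 llam M1 xiM lamxi m0.
have M0 : 0 < M by rewrite (lt_le_trans ltr01).
pose f k := norm (xi - (int_pair (2 ^ m0) k).2%:~R / (int_pair (2 ^ m0) k).1%:~R).
have [r r0 fr] := finite_positive_lower_bound f ((2 * 2 ^ m0).+1 ^ 2).
have l0 : - l < 0 by rewrite oppr_lt0 (lt_trans ltr01).
have [X1 hX1] := powR_neg_small l0 (exprn_gt0 n M0) r0.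
have l1' : 1 - l < 0 by rewrite subr_lt0.
have M20 : 0 < 2 * M by rewrite mulr_gt0.
have [X2 hX2] := powR_neg_small l1' M20 ltr01.
have [X] := lambda_exponent_solvable llam lamxi (Num.max 2 (Num.max X1 X2)).
rewrite !ge_max => /and3P[X2' /hX1 {}hX1 /hX2 {}hX2] solv.
have X1' : 1 < X by rewrite (lt_le_trans _ X2')// ltr1n.
have X0 : 0 < X by rewrite (lt_trans ltr01).
have [a [b [a0 abxi aX bX abe]]] :=
  approx_solvable_rational p_prime n_gt0 l1 X1' M1 xiM hX2 solv.
set H := Num.max _ _ in abe.
have HX : H ^+ n <= X by rewrite /H maxEle; case: ifP.
pose h := maxn `|a| `|b|.
have hE : H = h%:R.
  by rewrite /H -!abszE -!pmulrn /h -natr_max.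
have h0 : (0 < h)%N by rewrite leq_max absz_gt0 a0.
have /andP[hm hm'] := trunc_log_bounds (isT : (1 < 2)%N) h0.
set m := trunc_log 2 h in hm hm'.
have H1 : 1 <= H by rewrite hE ler1n.
have H0 : 0 < H ^+ n by rewrite exprn_gt0// (lt_le_trans ltr01).
have ah : (`|a| <= h)%N by exact: leq_maxl.
have bh : (`|b| <= h)%N by exact: leq_maxr.
exists m, a, b; split.
- rewrite leqNgt; apply/negP => mm0.
  have hm0 : (h <= 2 ^ m0)%N.
    by rewrite (leq_trans (ltnW hm'))// leq_exp2l.
  have [k kN kE] := int_pair_surj (leq_trans ah hm0) (leq_trans bh hm0).
  have := fr k kN; rewrite /f kE/= padic_norm_gt0 subr_eq0 eq_sym => /(_ abxi).
  apply/negP; rewrite -ltNge (le_lt_trans abe)// (le_lt_trans _ hX1)//.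
  rewrite ler_pdivrMr// ler_peMr ?mulr_ge0 ?powR_ge0 ?exprn_ge0 ?(ltW M0)//.
  by rewrite exprn_ege1.
- exact: leq_trans ah (ltnW hm').
- exact: leq_trans bh (ltnW hm').
apply: le_trans abe _; rewrite /shell_radius -mulrA ler_wpM2l ?exprn_ge0 ?(ltW M0)//.
set P := 2 ^+ m; have P0 : 0 < P by rewrite exprn_gt0.
have PH : P <= H by rewrite hE /P -natrX ler_nat.
have Pn0 : 0 < P ^+ n by rewrite exprn_gt0.
have PHn : P ^+ n <= H ^+ n by rewrite lerXn2r// nnegrE ltW// (lt_le_trans P0).
have -> : P `^ (- (n%:R * (1 + l))) = (P ^+ n) `^ (- l) / P ^+ n.
  rewrite -powR_mulrn ?(ltW P0)// -powRrM -powRB ?(gt_eqF P0) ?implybT//.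
  by congr (_ `^ _); ring.
apply: ler_pM; rewrite ?powR_ge0 ?invr_ge0 ?(ltW H0)//; last by rewrite lef_pV2.
rewrite !powRN lef_pV2 ?posrE ?powR_gt0// ge0_ler_powR ?nnegrE ?(ltW X0) ?(ltW Pn0)//.
  by rewrite -oppr_le0 ltW.
exact: le_trans PHn HX.
Qed.

(** There are at most 25 * 4^m pairs (a, b) with |a|, |b| <= 2^(m+1), each
    contributing the s-th power of shell_radius l M m, so that the cover by all the
    balls with m >= m0 has the size of the tail of a geometric series of ratio
    4 * 2^(- n (1 + l) s), and this is less than 1. *)
Lemma null_cover_lambda_exponent_ge (s lam : R) : 1 < lam ->
  2 / (n%:R * (1 + lam)) < s ->
  null_cover s [set xi : K | (lam%:E <= lambda_exponent n xi)%E].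
Proof.
move=> lam1 slam.
have n0 : 0 < n%:R :> R by rewrite ltr0n.
have nl0 : 0 < n%:R * (1 + lam) by rewrite mulr_gt0// addr_gt0// (lt_trans ltr01).
have s0 : 0 < s by rewrite (lt_trans _ slam)// divr_gt0.
have sn0 : 0 < s * n%:R by rewrite mulr_gt0.
(* By continuity the inequality s n (1 + lam) > 2 persists for some l < lam. *)
have [l [l1 llam sl]] : exists l, [/\ 1 < l, l < lam & 2 < s * n%:R * (1 + l)].
  have h : 2 / (s * n%:R) - 1 < lam.
    rewrite ltrBlDr ltr_pdivrMr//; move: slam; rewrite ltr_pdivrMr// => slam.
    by rewrite (lt_le_trans slam)// le_eqVlt; apply/orP; left; apply/eqP; ring.
  pose z := Num.max 1 (2 / (s * n%:R) - 1).
  have zlam : z < lam by rewrite gt_max lam1.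
  have [z1 z2] : 1 <= z /\ 2 / (s * n%:R) - 1 <= z by rewrite !le_max !lexx orbT.
  exists ((z + lam) / 2); split; [lra|lra|].
  rewrite mulrC -ltr_pdivrMr//; lra.
apply: (@null_cover_subset _ _ _ _ (\bigcup_N
    [set xi : K | (lam%:E <= lambda_exponent n xi)%E /\ norm xi <= N.+1%:R])).
  move=> xi xil.
  exists (Num.bound (norm xi)) => //; split=> //.
  rewrite (le_trans (ltW (archi_boundP (padic_norm_ge0 xi))))//.
  by rewrite ler_nat.
apply: null_cover_bigcup => N e e0.
set M : R := N.+1%:R; have M1 : 1 <= M by rewrite ler1n.
have M0 : 0 < M by rewrite (lt_le_trans ltr01).
set E := n%:R * (1 + l) * s.
have E2 : 2 < E by rewrite /E [X in _ < X](_ : _ = s * n%:R * (1 + l))//; ring.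
set c := 2 `^ (- E) : R; have c0 : 0 < c by rewrite powR_gt0.
set q := 4 * c.
have q0 : 0 < q by rewrite mulr_gt0.
have q1 : q < 1.
  have qE : q = (2 `^ (E - 2))^-1.
    by rewrite -powRN opprB powRB ?pnatr_eq0 ?implybT// /q /c powRN powR_mulrn// -natrX.
  rewrite qE invf_lt1 ?powR_gt0//.
  have := gt0_ltr_powR (_ : 0 < E - 2) (_ : 1 \in Num.nneg) (_ : 2 \in Num.nneg) (ltr1n R 2).
  by rewrite !nnegrE powR1; apply; rewrite // subr_gt0.
set C := 25 * (M ^+ n) `^ s; have C0 : 0 < C by rewrite mulr_gt0// powR_gt0// exprn_gt0.
have radiusE m : (shell_radius l M m) `^ s = (M ^+ n) `^ s * c ^+ m.
  rewrite /shell_radius powRM ?exprn_ge0 ?(ltW M0) ?powR_ge0//; congr (_ * _).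
  rewrite -powRrM mulNr -/E -powR_mulrn// -powRrM mulrC powRrM powR_mulrn//.
have radius_ge0 m : 0 <= shell_radius l M m.
  by rewrite mulr_ge0 ?powR_ge0// exprn_ge0// ltW.
have [m0 hm0] : exists m0, C * q ^+ m0 / (1 - q) <= e.
  have e1 : 0 < e * (1 - q) / C by rewrite divr_gt0// mulr_gt0// subr_gt0.
  have hq : `|q| < 1 by rewrite ger0_norm// ltW.
  have [m0 _ /(_ m0 (leqnn _)) h] := cvgr_lt _ (cvg_geometric 1 hq) _ e1.
  exists m0; rewrite ler_pdivrMr ?subr_gt0// -ler_pdivlMl// mulrC ltW//.
  by move: h; rewrite /= mul1r.
pose h m := (2 ^ m.+1)%N.
pose ball m k : set K := [set xi | norm (xi - (int_pair (h m) k).2%:~R /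
    (int_pair (h m) k).1%:~R) <= shell_radius l M m].
pose U i k : set K := if (k < (2 * h (m0 + i)).+1 ^ 2)%N then ball (m0 + i)%N k else set0.
apply: (@merge_cover _ _ U).
  move=> xi [xil xiN]; have [m [a [b [mm0 ah bh xiab]]]] :=
    lambda_exponent_near_rational l1 llam M1 xiN xil m0.
  have [k kh kE] := int_pair_surj ah bh.
  exists (m - m0)%N => //; exists k => //.
  by rewrite /U /ball subnKC// /h kh kE.
apply: (@le_trans _ _ (\sum_(0 <= i <oo) ((C * q ^+ m0) * q ^+ i)%:E)%E); last first.
  apply: le_trans (nneseries_geometric_le _ _) _; rewrite ?q0//.
  by rewrite mulr_ge0 ?exprn_ge0 ?ltW.
apply: lee_nneseries => [i _ _|i _].
  by apply: nneseries_ge0 => k _ _; exact: diameter_pow_ge0.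
apply: le_trans (nneseries_const_le (c := (M ^+ n) `^ s * c ^+ (m0 + i))
  (N := (2 * h (m0 + i)).+1 ^ 2) _ _ _) _.
- by move=> k; exact: diameter_pow_ge0.
- move=> k kN; rewrite /U kN -radiusE; apply: diameter_pow_le => //; first exact: ltW.
  move=> x y; rewrite /ball /= padic_mdistE => xr yr.
  by apply: padic_dist_le_trans xr _; rewrite padic_normB.
- by move=> k kN; rewrite /U ltnNge kN/= diameter_pow_set0.
rewrite lee_fin -[leRHS]mulrA -exprD /C /q exprMn.
rewrite [leRHS](_ : _ = 25 * 4 ^+ (m0 + i) * ((M ^+ n) `^ s * c ^+ (m0 + i))); last by ring.
rewrite ler_wpM2r ?mulr_ge0 ?powR_ge0 ?exprn_ge0 ?(ltW c0)//.
by rewrite -[4 ^+ _]natrX -[25 * _]natrM ler_nat; exact: shell_card.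
Qed.

End UpperBound.

(** * Counting the rational numbers of bounded height *)

(** Telescoping, as 1/(g+1)^2 <= 1/g - 1/(g+1); both sides agree at G = 2. *)
Lemma sum_inv_sqr_le (F : realFieldType) (G : nat) : (2 <= G)%N ->
  \sum_(2 <= g < G.+1) (g%:R ^- 2) <= 3 / 4 - G%:R^-1 :> F.
Proof.
elim: G => [//|G IH]; rewrite leq_eqVlt => /predU1P[<-|].
  by rewrite big_nat1; lra.
rewrite ltnS => G2.
rewrite big_nat_recr ?(leqW G2)//=; apply: le_trans (lerD (IH G2) (lexx _)) _.
have G0 : 0 < G%:R :> F by rewrite ltr0n (leq_trans _ G2).
have -> : G.+1%:R = G%:R + 1 :> F by rewrite -addn1 natrD.
move: G0; move: (G%:R : F) => x x0; have x1 : 0 < x + 1 by lra.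
rewrite -subr_ge0 (_ : _ - _ = (x * (x + 1) ^+ 2)^-1); last first.
  by field; rewrite !gt_eqF.
by rewrite invr_ge0 mulr_ge0 ?exprn_ge0// ltW.
Qed.

Lemma sum_divn_sqr_le (H : nat) :
  (4 * \sum_(2 <= g < H.+1) (H %/ g) ^ 2 <= 3 * H ^ 2)%N.
Proof.
have [H2|H2] := leqP 2 H; last by rewrite big_geq ?muln0.
rewrite -(ler_nat rat) [leLHS]natrM natr_sum [leRHS]natrM natrX.
apply: (@le_trans _ _ (4 * (H%:R ^+ 2 * \sum_(2 <= g < H.+1) (g%:R ^- 2)))).
  rewrite ler_wpM2l// mulr_sumr big_nat [leRHS]big_nat; apply: ler_sum => g /andP[g2 _].
  have g0 : 0 < g%:R :> rat by rewrite ltr0n (leq_trans _ g2).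
  rewrite -exprVn -exprMn natrX lerXn2r ?nnegrE ?divr_ge0//.
  by rewrite ler_pdivlMr// -natrM ler_nat leq_divM.
have := sum_inv_sqr_le rat H2; have : 0 <= H%:R^-1 :> rat by rewrite invr_ge0.
have : 0 <= H%:R ^+ 2 :> rat by rewrite exprn_ge0.
by move: (\sum_(_ <= _ < _) _) => S; nra.
Qed.

Section CoprimePairs.
Variables (p H : nat).
Hypothesis p_prime : prime p.

Let cnt (P : nat -> nat -> bool) :=
  (\sum_(1 <= a < H.+1) \sum_(1 <= t < H.+1) P a t)%N.

Let cntT : cnt (fun _ _ => true) = (H ^ 2)%N.
Proof.
rewrite /cnt; under eq_bigr do rewrite sum_nat_const_nat muln1 subn1.
by rewrite sum_nat_const_nat subn1 mulnn.
Qed.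

(** A pair with a common factor is divisible by some g >= 2, and the pairs
    divisible by g are (H / g)^2 in number; as the sum of the 1 / g^2 is at most
    3/4, a quarter of the pairs are coprime. *)
Lemma coprime_pairs_count :
  (H ^ 2 <= 4 * \sum_(1 <= a < H.+1) \sum_(1 <= t < H.+1) coprime a t)%N.
Proof.
have h : (cnt (fun a t => ~~ coprime a t) <= \sum_(2 <= g < H.+1) (H %/ g) ^ 2)%N.
  have -> : (\sum_(2 <= g < H.+1) (H %/ g) ^ 2 = \sum_(1 <= a < H.+1)
      \sum_(1 <= t < H.+1) \sum_(2 <= g < H.+1) (g %| a) * (g %| t))%N.
    under [RHS]eq_bigr do rewrite exchange_big/=.
    rewrite [RHS]exchange_big/=; apply: eq_bigr => g _.
    rewrite -mulnn {1}divn_count_dvd big_distrl/=; apply: eq_bigr => a _.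
    by rewrite divn_count_dvd big_distrr.
  rewrite /cnt big_nat [leqRHS]big_nat; apply: leq_sum => a /andP[a0 aH].
  rewrite big_nat [leqRHS]big_nat; apply: leq_sum => t /andP[t0 tH].
  have [//|nc] := boolP (coprime a t).
  have g2 : (2 <= gcdn a t < H.+1)%N.
    rewrite ltn_neqAle eq_sym nc gcdn_gt0 a0/= ltnS.
    by rewrite (leq_trans _ (aH : a <= H)%N)// dvdn_leq// dvdn_gcdl.
  rewrite (big_rem (gcdn a t))/= ?mem_index_iota//.
  by rewrite dvdn_gcdl dvdn_gcdr.
have e : (cnt (fun a t => coprime a t) + cnt (fun a t => ~~ coprime a t) = H ^ 2)%N.
  rewrite -cntT /cnt -big_split/=; apply: eq_bigr => a _.
  by rewrite -big_split/=; apply: eq_bigr => t _; case: coprime.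
have := sum_divn_sqr_le H; rewrite -/(cnt (fun a t => coprime a t)); lia.
Qed.

(** In a coprime pair p divides at most one entry; by symmetry it spares the
    first one in at least half of the pairs. *)
Lemma coprime_pairs_count_prime : (H ^ 2 <= 8 * \sum_(1 <= a < H.+1)
  \sum_(1 <= t < H.+1) (coprime a t && ~~ (p %| a)%N))%N.
Proof.
have := coprime_pairs_count.
rewrite -/(cnt (fun a t => coprime a t)) -/(cnt (fun a t => coprime a t && ~~ (p %| a)%N)).
have sym : cnt (fun a t => coprime a t && ~~ (p %| t)%N) =
    cnt (fun a t => coprime a t && ~~ (p %| a)%N).
  rewrite /cnt exchange_big/=; apply: eq_bigr => a _; apply: eq_bigr => t _.
  by rewrite coprime_sym.
have : (cnt (fun a t => coprime a t) <= cnt (fun a t => coprime a t && ~~ (p %| a)%N) +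
   cnt (fun a t => coprime a t && ~~ (p %| t)%N))%N.
  rewrite /cnt -big_split/=; apply: leq_sum => a _.
  rewrite -big_split/=; apply: leq_sum => t _.
  case: (boolP (coprime a t)) => //= cat.
  have [pa|//] := boolP (p %| a)%N; have [pt|//] := boolP (p %| t)%N.
  have : (p %| gcdn a t)%N by rewrite dvdn_gcd pa.
  by rewrite (eqP cat) dvdn1 => /eqP p1; move: p_prime; rewrite p1.
rewrite sym; lia.
Qed.

Definition coprime_pairs : seq (nat * nat) :=
  [seq x <- [seq (a, t) | a <- index_iota 1 H.+1, t <- index_iota 1 H.+1] |
    coprime x.1 x.2 && ~~ (p %| x.1)%N].

Lemma size_coprime_pairs : (H ^ 2 <= 8 * size coprime_pairs)%N.
Proof.
apply: leq_trans coprime_pairs_count_prime _; rewrite leq_mul2l/=.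
rewrite /coprime_pairs size_filter -sum1_count [leqRHS]big_mkcond big_allpairs_dep/=.
by apply: leq_sum => a _; apply: leq_sum => t _; case: ifP.
Qed.

Lemma uniq_coprime_pairs : uniq coprime_pairs.
Proof.
by rewrite filter_uniq// allpairs_uniq ?iota_uniq// => -[a t] [a' t'] _ _ [-> ->].
Qed.

Lemma mem_coprime_pairs a t : (a, t) \in coprime_pairs ->
  [/\ (0 < a <= H)%N, (0 < t <= H)%N, coprime a t & ~~ (p %| a)%N].
Proof.
rewrite mem_filter/= => /andP[/andP[cat pa] /allpairsP[[a' t'] /= [+ + [aE tE]]]].
by rewrite !mem_index_iota -aE -tE.
Qed.

End CoprimePairs.

Lemma coprime_fraction_inj (a t a' t' : nat) : (0 < a)%N -> coprime a t -> coprime a' t' ->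
  (a * t' = a' * t)%N -> (a, t) = (a', t').
Proof.
move=> a0 c c' e.
have aa' : (a %| a')%N by rewrite -(Gauss_dvdl _ c) -e dvdn_mulr.
have a'a : (a' %| a)%N by rewrite -(Gauss_dvdl _ c') e dvdn_mulr.
have aE : a = a' by apply/eqP; rewrite eqn_dvd aa' a'a.
by rewrite aE in e a0 *; move/eqP: e; rewrite eqn_pmul2l// => /eqP ->.
Qed.

(** If two fractions t/a and t'/a' of height at most p^m agree modulo p^(2m), then
    they are equal, since a' t and a t' both lie between 1 and p^(2m).  So each
    coprime pair with a prime to p yields its own class. *)
Lemma fraction_residues (p m Q : nat) : prime p -> (2 * m <= Q)%N ->
  exists S : seq nat, [/\ uniq [seq r %% p ^ (2 * m) | r <- S]%N,
    (p ^ (2 * m) <= 8 * size S)%N &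
    forall r, r \in S -> (r < p ^ Q)%N /\ exists a t, [/\ (0 < a <= p ^ m)%N,
      (t <= p ^ m)%N & a * r = t %[mod p ^ Q]]%N].
Proof.
move=> p_prime mQ; set N := (p ^ Q)%N; set P := coprime_pairs p (p ^ m).
have N0 : (0 < N)%N by rewrite expn_gt0 prime_gt0.
have /choice[f fE] : forall x : nat * nat, exists r, ~~ (p %| x.1)%N ->
    (r < N)%N /\ (x.1 * r = x.2 %[mod N])%N.
  move=> [a t] /=; have [pa|pa] := boolP (p %| a)%N; first by exists 0%N.
  have a0 : (0 < a)%N by case: a pa => //; rewrite dvdn0.
  have : coprime a N by rewrite coprime_sym coprimeXl// prime_coprime.
  move=> /(coprimeP _ a0)[[u v] /= uv]; exists ((t * u) %% N)%N => _.
  rewrite ltn_pmod//; split=> //; rewrite modnMmr.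
  have -> : (a * (t * u) = (v * t) * N + t)%N by nia.
  by rewrite modnMDl.
exists [seq f x | x <- P]; split.
- rewrite -map_comp map_inj_in_uniq ?uniq_coprime_pairs//.
  move=> [a t] [a' t'] /mem_coprime_pairs[/andP[a0 aH] /andP[t0 tH] c pa].
  move=> /mem_coprime_pairs[/andP[a0' aH'] /andP[t0' tH'] c' pa'] /= ff.
  apply: (coprime_fraction_inj a0 c c').
  have [_ /= e1] := fE (a, t) pa; have [_ /= e2] := fE (a', t') pa'.
  set M := (p ^ (2 * m))%N in ff.
  have MN : (M %| N)%N by rewrite dvdn_exp2l.
  have {}e1 : (a * f (a, t) = t %[mod M])%N by rewrite -(modn_dvdm _ MN) e1 modn_dvdm.
  have {}e2 : (a' * f (a', t') = t' %[mod M])%N by rewrite -(modn_dvdm _ MN) e2 modn_dvdm.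
  have e : (a * t' = a' * t %[mod M])%N.
    rewrite -modnMmr -e2 modnMmr -[RHS]modnMmr -e1 modnMmr.
    by rewrite mulnCA !mulnA -[LHS]modnMmr -ff modnMmr.
  have ME : M = (p ^ m * p ^ m)%N by rewrite /M mul2n -addnn expnD.
  have b1 : (0 < a * t' <= M)%N by rewrite muln_gt0 a0 t0' ME leq_mul.
  have b2 : (0 < a' * t <= M)%N by rewrite muln_gt0 a0' t0 ME leq_mul.
  move: e b1 b2; set x := (a * t')%N; set y := (a' * t)%N => e /andP[x0 xM] /andP[y0 yM].
  have : ((x.-1) + 1 = (y.-1) + 1 %[mod M])%N by rewrite !addn1 !prednK.
  move=> /eqP; rewrite eqn_modDr !modn_small ?prednK// => /eqP xy.
  by rewrite -(prednK x0) -(prednK y0) xy.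
- by rewrite size_map mulnC expnM size_coprime_pairs.
move=> _ /mapP[[a t] /mem_coprime_pairs[a0 /andP[t0 tH] c pa] ->].
have [fN fa] := fE (a, t) pa; split=> //; by exists a, t.
Qed.

Lemma size_congruent (a b : nat) (S : seq nat) : (0 < a)%N -> (0 < b)%N ->
  uniq [seq r %% (a * b) | r <- S]%N ->
  (forall r r', r \in S -> r' \in S -> r = r' %[mod a])%N -> (size S <= b)%N.
Proof.
move=> a0 b0 Su Sa; rewrite -(size_iota 0 b) -(size_map (fun r => (r %% (a * b)) %/ a)%N).
apply: uniq_leq_size => [|_ /mapP[r rS ->]]; last first.
  by rewrite mem_iota add0n/= ltn_divLR// mulnC ltn_pmod// muln_gt0 b0 a0.
rewrite (map_comp (fun r => r %/ a)%N (fun r => r %% (a * b))%N) map_inj_in_uniq//.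
  move=> x y /mapP[r rS ->] /mapP[r' rS' ->] /= e.
  rewrite (divn_eq (r %% (a * b)) a) (divn_eq (r' %% (a * b)) a) e.
  by rewrite !modn_dvdm ?dvdn_mulr// (Sa _ _ rS rS').
Qed.

(** * A Cantor set of positive Hausdorff measure *)

(** A node of level j is a ball of radius p^(- lev j) centred at a natural number
    c; its children are the balls of radius p^(- lev (j+1)) centred at the
    c + p^(lev j) r, for r in S j.  The unit mass of the root 0 is divided equally
    among the children at each level. *)
Section CantorSet.
Variables (R : realType) (p : nat) (s : R) (lev m : nat -> nat) (S : nat -> seq nat).
Hypotheses (p_prime : prime p) (s_gt0 : 0 < s) (s_le1 : s <= 1).
Hypotheses (lev0 : lev 0%N = 0%N).
Hypothesis lev_m : forall j, (lev j + 2 * m j <= lev j.+1)%N.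
Hypothesis s_lev : forall j, s * (lev j.+1)%:R + 4 <= (2 * m j)%:R.
Hypothesis S_uniq : forall j, uniq [seq r %% p ^ (2 * m j) | r <- S j]%N.
Hypothesis S_size : forall j, (p ^ (2 * m j) <= 8 * size (S j))%N.
Local Notation K := (Qp R p).
Local Notation norm := (@padic_norm R p).

Let p_gt1 : 1 < p%:R :> R. Proof. by rewrite ltr1n prime_gt1. Qed.
Let p_gt0 : 0 < p%:R :> R. Proof. exact: lt_trans ltr01 p_gt1. Qed.
Let pX_gt0 k : 0 < p%:R ^+ k :> R. Proof. by rewrite exprn_gt0. Qed.

Let lev_le j : (lev j <= lev j.+1)%N.
Proof. by apply: leq_trans (lev_m j); rewrite leq_addr. Qed.

Let m_gt0 j : (0 < m j)%N.
Proof.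
rewrite lt0n; apply/eqP => m0; have := s_lev j; rewrite m0 muln0.
have : 0 <= s * (lev j.+1)%:R by rewrite mulr_ge0// ltW.
lra.
Qed.

Let leq_lev j : (j <= lev j)%N.
Proof. by elim: j => // j IH; have := lev_m j; have := m_gt0 j; lia. Qed.

Let S_gt0 j : (0 < size (S j))%N.
Proof.
have := S_size j; case: (size _) => //; rewrite muln0 leqn0 expn_eq0.
by have := prime_gt0 p_prime; case: p.
Qed.

Fixpoint mass j : R := if j is i.+1 then mass i / (size (S i))%:R else 1.

(** The s-th power of the radius p^(-u). *)
Definition ball_size (u : nat) : R := p%:R `^ (- (s * u%:R)).

Let mass_gt0 j : 0 < mass j.
Proof. by elim: j => //= j IH; rewrite divr_gt0// ltr0n. Qed.

Let mass_le1 j : mass j <= 1.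
Proof.
elim: j => //= j IH; rewrite ler_pdivrMr ?ltr0n// mul1r (le_trans IH)//.
by rewrite ler1n.
Qed.

Let massS j : mass j.+1 <= 8 * mass j / p%:R ^+ (2 * m j).
Proof.
have h : p%:R ^+ (2 * m j) <= 8 * (size (S j))%:R :> R.
  by rewrite -natrX -natrM ler_nat.
rewrite /= ler_pdivrMr ?ltr0n// mulrAC ler_pdivlMr//.
rewrite (_ : 8 * _ * _ = mass j * (8 * (size (S j))%:R)); last by ring.
by rewrite ler_pM2l.
Qed.

Let ball_size_gt0 u : 0 < ball_size u. Proof. by rewrite powR_gt0. Qed.

Let ball_size_dec u v : (u <= v)%N -> ball_size v <= ball_size u.
Proof.
by move=> uv; rewrite ler_powR ?(ltW p_gt1)// lerN2 ler_pM2l// ler_nat.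
Qed.

(** The summand 4 in s_lev absorbs the factor 8 lost in the number of children,
    since 8 <= p^4. *)
Let mass_le j : mass j <= ball_size (lev j).
Proof.
case: j => [|j]; first by rewrite lev0 /ball_size mulr0 oppr0 powRr0.
apply: (le_trans (massS j)); rewrite ler_pdivrMr//.
apply: (@le_trans _ _ (p%:R ^+ 4)).
  apply: (@le_trans _ _ 8); first by rewrite ler_piMr.
  have p2 : 2 <= p%:R :> R by rewrite ler_nat prime_gt1.
  have : 2 ^+ 4 <= p%:R ^+ 4 :> R by rewrite lerXn2r ?nnegrE// ltW.
  by apply: le_trans; rewrite -natrX ler_nat.
rewrite -!powR_mulrn ?(ltW p_gt0)// /ball_size -powRD ?(gt_eqF p_gt0) ?implybT//.
rewrite ler_powR ?(ltW p_gt1)//; have := s_lev j; lra.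
Qed.

Let child_dist j (c r r' : nat) : (c + p ^ lev j * r)%:R - (c + p ^ lev j * r')%:R =
  p%:R ^+ lev j * (r%:Z - r'%:Z)%:~R :> K.
Proof.
by rewrite !natrD !natrM !natrX rmorphB/= -!pmulrn; ring.
Qed.

Let child_near j (c r : nat) : norm ((c + p ^ lev j * r)%:R - c%:R) <= (p%:R ^+ lev j)^-1.
Proof.
rewrite natrD natrM natrX addrAC subrr add0r padic_normM padic_norm_pX//.
by rewrite ler_piMr ?invr_ge0 ?(ltW (pX_gt0 _))// [r%:R]pmulrn padic_norm_int_le1.
Qed.

Definition near_child j (c : nat) (y : K) v : pred nat :=
  fun r => norm ((c + p ^ lev j * r)%:R - y) <= (p%:R ^+ v)^-1.

(** The children counted agree modulo p^(v - lev j), and distinct children differ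
    modulo p^(2 m j). *)
Let count_near_child j c y v : (lev j <= v)%N ->
  (count (near_child j c y v) (S j) <= p ^ (2 * m j - (v - lev j)))%N.
Proof.
move=> jv; rewrite -size_filter; set v' := minn (v - lev j) (2 * m j).
have p0 k : (0 < p ^ k)%N by rewrite expn_gt0 prime_gt0.
have -> : (2 * m j - (v - lev j) = 2 * m j - v')%N by rewrite /v'; lia.
apply: (size_congruent (p0 v') (p0 _)).
  rewrite -expnD subnKC ?geq_minr//.
  by apply: subseq_uniq (S_uniq j); apply: map_subseq; exact: filter_subseq.
move=> r r'; rewrite !mem_filter => /andP[ry _] /andP[ry' _].
have : norm ((c + p ^ lev j * r)%:R - (c + p ^ lev j * r')%:R) <= (p%:R ^+ v)^-1.
  by apply: padic_dist_le_trans ry _; rewrite padic_normB.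
rewrite child_dist padic_normM padic_norm_pX// -(subnKC jv) exprD invfM.
rewrite ler_pM2l ?invr_gt0// padic_norm_int_dvd// => h.
have {}h : (p ^ v' %| `|(r%:Z - r'%:Z)%R|)%N.
  by apply: dvdn_trans h; rewrite dvdn_exp2l// geq_minl.
apply/eqP; have : (r%:Z == r'%:Z %[mod (p ^ v')%N])%Z by rewrite eqz_mod_dvd.
by rewrite !modz_nat eqz_nat.
Qed.

(** An upper bound for the mass of the part of a ball of radius p^(-u) lying
    in the node c of level j: the full mass when the ball contains the node, and
    otherwise the bound valid for every ball of this radius. *)
Definition load (y : K) u j (c : nat) : R :=
  if norm (c%:R - y) <= (p%:R ^+ minn (lev j) u)^-1 then
    if (u <= lev j)%N then mass j else 8 * ball_size u
  else 0.

Let load_ge0 y u j c : 0 <= load y u j c.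
Proof.
rewrite /load; case: ifP => // _; case: ifP => _; first exact: ltW.
by rewrite mulr_ge0// ltW.
Qed.

(** When the ball meets the node without containing it, there are two cases.
    Either it contains some of the children: at most p^(2 m j - (u - lev j)) of
    them, or at most one, and their mass is small enough.  Or it is smaller than
    the children and meets at most one of them. *)
Let load_sum_le y u j (c : nat) :
  \sum_(r <- S j) load y u j.+1 (c + p ^ lev j * r) <= load y u j c.
Proof.
have far : (p%:R ^+ minn (lev j) u)^-1 < norm (c%:R - y) ->
    \sum_(r <- S j) load y u j.+1 (c + p ^ lev j * r) = 0.
  move=> cy; apply: big1 => r _; rewrite /load ifF//.
  apply/negP => h; move: cy; apply/negP; rewrite -leNgt.
  have le1 : (minn (lev j) u <= minn (lev j.+1) u)%N.
    by rewrite leq_min geq_minr (leq_trans (geq_minl _ _) (lev_le j)).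
  have := le_trans h (padic_norm_dec R p_prime le1).
  apply: padic_dist_le_trans; rewrite padic_normB.
  by apply: le_trans (child_near _ _ _) _; apply: padic_norm_dec; rewrite ?geq_minl.
rewrite {2}/load; case: ifPn => [cy|]; last by rewrite -ltNge => /far ->.
case: leqP => [uj|ju].
  apply: (@le_trans _ _ (\sum_(r <- S j) mass j.+1)).
    apply: ler_sum => r _; rewrite /load (leq_trans uj (lev_le j)).
    by case: ifP => // _; exact: ltW.
  rewrite big_const_seq count_predT iter_addr_0 /= -[leLHS]mulr_natr divfK//.
  by rewrite pnatr_eq0 -lt0n.
have sumE v (z : R) : (forall r, load y u j.+1 (c + p ^ lev j * r) =
      if near_child j c y v r then z else 0) ->
    \sum_(r <- S j) load y u j.+1 (c + p ^ lev j * r) =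
    z *+ count (near_child j c y v) (S j).
  move=> E; under eq_bigr do rewrite E.
  by rewrite -big_mkcond/= big_const_seq iter_addr_0.
have [uj1|uj1] := leqP u (lev j.+1).
  rewrite (sumE u (mass j.+1)); last first.
    by move=> r; rewrite /load uj1 (minn_idPr uj1).
  have cnt := count_near_child c y (ltnW ju).
  have [v'm|mv'] := leqP (u - lev j) (2 * m j).
    apply: (@le_trans _ _ (mass j.+1 * p%:R ^+ (2 * m j - (u - lev j)))).
      by rewrite -[leLHS]mulr_natr ler_wpM2l ?(ltW (mass_gt0 _))// -natrX ler_nat.
    apply: (@le_trans _ _ (8 * mass j / p%:R ^+ (u - lev j))).
      apply: le_trans (ler_wpM2r (ltW (pX_gt0 _)) (massS j)) _.
      rewrite -[in X in _ / X](subnK v'm) exprD invfM mulrA mulrAC divfK ?gt_eqF//.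
    rewrite -mulrA ler_pM2l//; apply: le_trans (ler_wpM2r _ (mass_le j)) _.
      by rewrite invr_ge0 ltW.
    rewrite /ball_size -powR_mulrn ?(ltW p_gt0)// -powRN -powRD ?(gt_eqF p_gt0) ?implybT//.
    rewrite ler_powR ?(ltW p_gt1)// natrB ?(ltnW ju)//.
    have : 0 <= (1 - s) * (u%:R - (lev j)%:R).
      by rewrite mulr_ge0// subr_ge0// ler_nat ltnW.
    lra.
  apply: (@le_trans _ _ (mass j.+1)).
    rewrite -[leLHS]mulr_natr ler_piMr ?(ltW (mass_gt0 _))// lern1 (leq_trans cnt)//.
    by move/ltnW: mv'; rewrite -subn_eq0 => /eqP ->.
  rewrite (le_trans (mass_le _))// (le_trans (ball_size_dec uj1))//.
  by rewrite ler_peMl ?ler1n// ltW.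
rewrite (sumE (lev j.+1) (8 * ball_size u)); last first.
  by move=> r; rewrite /load leqNgt uj1 /= (minn_idPl (ltnW uj1)).
rewrite -[leLHS]mulr_natr ler_piMr ?mulr_ge0 ?(ltW (ball_size_gt0 _))//.
rewrite lern1 (leq_trans (count_near_child c y (lev_le j)))//.
by have := lev_m j; rewrite -leq_subRL// -subn_eq0 => /eqP ->.
Qed.

Definition cantor_branch (c : nat -> nat) := c 0%N = 0%N /\
  forall j, exists2 r, r \in S j & c j.+1 = (c j + p ^ lev j * r)%N.

Definition cantor_set : set K := [set x | exists2 c, cantor_branch c &
  forall j, norm (x - (c j)%:R) <= (p%:R ^+ lev j)^-1].

(** If the children of a node all had total load at least their mass, then so
    would the node. *)
Let light_branch (T : nat -> nat -> \bar R) :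
  (forall j c, \sum_(r <- S j) T j.+1 (c + p ^ lev j * r)%N <= T j c)%E ->
  (T 0%N 0%N < 1)%E ->
  exists2 c, cantor_branch c & forall j, (T j (c j) < (mass j)%:E)%E.
Proof.
move=> TS T0.
have step (x : nat * nat) : exists r, (T x.1 x.2 < (mass x.1)%:E)%E ->
    r \in S x.1 /\ (T x.1.+1 (x.2 + p ^ lev x.1 * r)%N < (mass x.1.+1)%:E)%E.
  case: x => j c /=; apply/not_existsP => H.
  have {}H r : (T j c < (mass j)%:E)%E /\
      (r \in S j -> ((mass j.+1)%:E <= T j.+1 (c + p ^ lev j * r)%N)%E).
    have /not_implyP[Tm /not_andP h] := H r; split=> // rS.
    by case: h => // /negP; rewrite -leNgt.
  have [Tm _] := H 0%N; move: Tm; apply/negP; rewrite -leNgt.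
  apply: le_trans (TS j c).
  apply: (@le_trans _ _ (\sum_(r <- S j) (mass j.+1)%:E)%E).
    rewrite sumEFin lee_fin big_const_seq count_predT iter_addr_0 -mulr_natr.
    by rewrite /= divfK// pnatr_eq0 -lt0n.
  rewrite big_seq [leRHS]big_seq; apply: lee_sum => r rS.
  by have [_] := H r; apply.
have {step} [f fE] := choice step.
pose c := fix c j := if j is i.+1 then (c i + p ^ lev i * f (i, c i))%N else 0%N.
have cT j : (T j (c j) < (mass j)%:E)%E.
  by elim: j => // j IH; have [_] := fE (j, c j) IH.
exists c => //; split=> // j; exists (f (j, c j)) => //.
by have [] := fE (j, c j) (cT j).
Qed.

(** If the loads of all the balls at the root added up to less than 1, there
    would be a branch along which they add up to less than the mass of the node.
    But the limit of this branch lies in one of the balls, which contains the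
    nodes of the branch from some level on and then has their full mass as its
    load. *)
Lemma cantor_set_balls (y : nat -> K) (u : nat -> nat) :
  cantor_set `<=` \bigcup_k [set x | norm (x - y k) <= (p%:R ^+ u k)^-1] ->
  (1 <= \sum_(0 <= k <oo) (8 * ball_size (u k))%:E)%E.
Proof.
move=> cov; rewrite leNgt; apply/negP => lt1.
pose T j c := (\sum_(0 <= k <oo) (load (y k) (u k) j c)%:E)%E.
have load0 k j c : (0 <= (load (y k) (u k) j c)%:E)%E by rewrite lee_fin.
have [] := @light_branch T.
- move=> j c; rewrite /T -nneseries_sum//.
  apply: lee_nneseries => [k _ _|k _]; first exact: sume_ge0.
  by rewrite sumEFin lee_fin load_sum_le.
- apply: le_lt_trans lt1; apply: lee_nneseries => // k _.
  rewrite lee_fin /load; case: ifP => _; last by rewrite mulr_ge0// ltW.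
  case: ifP => // u0 /=; move: u0; rewrite lev0 leqn0 => /eqP ->.
  by rewrite /ball_size mulr0 oppr0 powRr0 mulr1 ler1n.
move=> c cb cT.
have [x xc] : exists x, forall j, norm (x - (c j)%:R) <= (p%:R ^+ lev j)^-1.
  apply: (padic_limit p_prime leq_lev lev_le) => j.
  by have [_ /(_ j) [r _ ->]] := cb; exact: child_near.
have [k _ /= xk] := cov x (ex_intro2 _ _ c cb xc).
have := cT (u k); apply/negP; rewrite -leNgt.
apply: (@le_trans _ _ (load (y k) (u k) (u k) (c (u k)))%:E).
  rewrite /load leq_lev (minn_idPr (leq_lev _)) ifT//.
  apply: padic_dist_le_trans xk; rewrite padic_normB.
  by apply: le_trans (xc (u k)) _; exact: padic_norm_dec.
rewrite /T.
apply: (@le_trans _ _ (\sum_(0 <= i < k.+1) (load (y i) (u i) (u k) (c (u k)))%:E)%E).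
  by rewrite big_nat_recr//= leeDr// sume_ge0.
exact: nneseries_lim_ge.
Qed.

(** The points of A are at distance at most z^(1/s) from each other, and there is
    a power of p between this number and p times it. *)
Let ball_cover (A : set K) (z : R) : 0 < z <= 1 -> (diameter_pow s A <= z%:E)%E ->
  exists y u, A `<=` [set x | norm (x - y) <= (p%:R ^+ u)^-1] /\
    ball_size u <= p%:R `^ s * z.
Proof.
move=> /andP[z0 z1] Az; set d := z `^ s^-1.
have d0 : 0 < d by rewrite powR_gt0.
have sV : 0 <= s^-1 by rewrite invr_ge0 ltW.
have d1 : d <= 1.
  have := ge0_ler_powR sV (_ : z \in Num.nneg) (_ : 1 \in Num.nneg) z1.
  by rewrite !nnegrE powR1; apply; rewrite // ltW.
have ds : d `^ s = z by rewrite -powRrM mulVf ?gt_eqF// powRr1// ltW.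
have ex : exists k, (p%:R ^+ k)^-1 < d.
  have hq : `|p%:R^-1 : R| < 1 by rewrite ger0_norm ?invr_ge0 ?ltW// invf_lt1.
  have [k _ /(_ k (leqnn _)) h] := cvgr_lt _ (cvg_geometric 1 hq) _ d0.
  by exists k; move: h; rewrite /= mul1r exprVn.
case: (ex_minnP ex) => -[|u] pu umin.
  by move: pu; rewrite expr0 invr1 ltNge d1.
have du : d <= (p%:R ^+ u)^-1.
  by rewrite leNgt; apply/negP => /umin; rewrite ltnn.
have ball_sizeE k : ball_size k = ((p%:R ^+ k)^-1) `^ s.
  by rewrite /ball_size mulrC -mulNr powRrM powR_invn// ltW.
have uz : ball_size u <= p%:R `^ s * z.
  have h : ball_size u.+1 <= z.
    by rewrite ball_sizeE -ds ge0_ler_powR ?nnegrE ?invr_ge0 ?(ltW (pX_gt0 _)) ?ltW.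
  have -> : ball_size u = p%:R `^ s * ball_size u.+1.
    rewrite /ball_size -powRD ?(gt_eqF p_gt0) ?implybT//; congr (_ `^ _).
    by rewrite -addn1 natrD; ring.
  by rewrite ler_wpM2l ?powR_ge0.
have [A0|/set0P[y Ay]] := eqVneq A set0.
  by exists 0, u; split=> //; rewrite A0 => ?.
exists y, u; split=> // x Ax /=; apply: le_trans du; rewrite leNgt; apply/negP => xy.
have := mdist_pow_le_diameter_pow (ltW s_gt0) Ax Ay; apply/negP; rewrite -ltNge.
apply: le_lt_trans Az _; rewrite lte_fin -ds padic_mdistE.
by apply: gt0_ltr_powR => //; rewrite nnegrE ?padic_norm_ge0// ltW.
Qed.

(** By [ball_cover], replacing arbitrary sets by balls costs at most a factor p^s;
    adding e / 2^(k+1) to the size of the k-th set gives a positive radius even to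
    the balls around sets of diameter zero. *)
Lemma cantor_set_not_null : ~ null_cover s cantor_set.
Proof.
have ps0 : 0 < p%:R `^ s :> R by rewrite powR_gt0.
have ps1 : 1 <= p%:R `^ s :> R.
  by rewrite -[leLHS](powRr0 p%:R) ler_powR// ?ltW.
(* With this e the balls have total size at most 8 p^s (e + e) = 1/2 < 1. *)
set e : R := (32 * p%:R `^ s)^-1.
have e0 : 0 < e by rewrite invr_gt0 mulr_gt0.
have e32 : 32 * p%:R `^ s * e = 1 by rewrite mulfV// gt_eqF// mulr_gt0.
move=> /(_ e e0)[U [KU Ue]].
have Uk k : (diameter_pow s (U k) <= e%:E)%E.
  apply: le_trans Ue.
  apply: (@le_trans _ _ (\sum_(0 <= i < k.+1) diameter_pow s (U i))%E).
    by rewrite big_nat_recr//= leeDr// sume_ge0// => i _; exact: diameter_pow_ge0.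
  by apply: nneseries_lim_ge => i _ _; exact: diameter_pow_ge0.
pose z k := fine (diameter_pow s (U k)) + e / (2 ^ k.+1)%:R.
have eps_gt0 k : 0 < e / (2 ^ k.+1)%:R by rewrite divr_gt0// ltr0n expn_gt0.
have Ufin k : diameter_pow s (U k) \is a fin_num.
  by rewrite ge0_fin_numE ?diameter_pow_ge0// (le_lt_trans (Uk k))// ltry.
have zE k : (z k)%:E = (diameter_pow s (U k) + (e / (2 ^ k.+1)%:R)%:E)%E.
  by rewrite EFinD fineK.
have e1 : e + e <= 1.
  have : 2 * e <= 32 * p%:R `^ s * e.
    rewrite ler_wpM2r ?(ltW e0)//; lra.
  by rewrite e32; lra.
have z01 k : 0 < z k <= 1.
  rewrite ltr_wpDl ?fine_ge0 ?diameter_pow_ge0//=; apply: le_trans e1.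
  rewrite lerD//; first by rewrite -lee_fin fineK.
  rewrite ler_pdivrMr ?ltr0n ?expn_gt0// ler_peMr ?(ltW e0)//.
  by rewrite ler1n expn_gt0.
have Uz k : (diameter_pow s (U k) <= (z k)%:E)%E by rewrite zE leeDl// lee_fin ltW.
have /choice[yu yuE] : forall k, exists yu : K * nat,
    U k `<=` [set x | norm (x - yu.1) <= (p%:R ^+ yu.2)^-1] /\
    ball_size yu.2 <= p%:R `^ s * z k.
  by move=> k; have [y [u yu]] := ball_cover (z01 k) (Uz k); exists (y, u).
have cov : cantor_set `<=`
    \bigcup_k [set x | norm (x - (yu k).1) <= (p%:R ^+ (yu k).2)^-1].
  by move=> x /KU[k _ Ukx]; exists k => //; exact: (yuE k).1.
have := cantor_set_balls cov; apply/negP; rewrite -ltNge.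
apply: (@le_lt_trans _ _ (\sum_(0 <= k <oo) (8 * p%:R `^ s)%:E * (z k)%:E)%E).
  apply: lee_nneseries => [k _ _|k _]; rewrite lee_fin ?mulr_ge0 ?(ltW (ball_size_gt0 _))//.
  by rewrite -mulrA ler_pM2l// (yuE k).2.
rewrite nneseriesZl => [|k _]; last by rewrite lee_fin; case/andP: (z01 k) => /ltW.
have -> : (\sum_(0 <= k <oo) (z k)%:E =
    \sum_(0 <= k <oo) (diameter_pow s (U k) + (e / (2 ^ k.+1)%:R)%:E))%E.
  by apply: eq_eseriesr => k _; rewrite zE.
apply: (@le_lt_trans _ _ ((8 * p%:R `^ s)%:E * (e%:E + e%:E))%E).
  apply: lee_wpmul2l; first by rewrite lee_fin mulr_ge0// ltW.
  apply: le_trans (epsilon_trick _ (fun k => diameter_pow_ge0 s (U k)) (ltW e0)) _.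
  exact: leeD.
rewrite -EFinD -EFinM lte_fin; move: e32; move: (p%:R `^ s) (e) => a b; lra.
Qed.

End CantorSet.

(** * The points of the Cantor set are well approximable *)

Section Levels.
Variables (R : realType) (tau : R).
Hypothesis tau_gt4 : 4 < tau.

(** Level j + 1 is close to tau m, where m = height_exponent j; the 2 subtracted
    from m makes up for the 4 in [level_le].  The factor j + 1 in m makes level j,
    which adds to the heights of the approximations, negligible with respect to
    m; the constant 12 serves [level_height] and [height_exponent_ge]. *)
Fixpoint level (j : nat) : nat :=
  if j is i.+1 then Num.truncn (tau * (i.+1 * (level i + 12) - 2)%N%:R) else 0%N.

Definition height_exponent (j : nat) : nat := (j.+1 * (level j + 12))%N.

Lemma leq_height j : (j <= height_exponent j)%N.
Proof. by rewrite /height_exponent ltnW// leq_pmulr// addnC. Qed.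

Lemma height_exponent_ge j : (j.+1 * (level j + 4) + 3 <= height_exponent j)%N.
Proof.
rewrite /height_exponent -[12%N]/(4 + 8)%N addnA [leqRHS]mulnDr leq_add2l.
by rewrite (@leq_trans (1 * 8)) // leq_mul2r.
Qed.

Let height_ge j : (level j + 12 <= height_exponent j)%N.
Proof. by rewrite /height_exponent mulSn leq_addr. Qed.

Let levelS j : (level j.+1)%:R <= tau * ((height_exponent j)%:R - 2) <
  (level j.+1)%:R + 1.
Proof.
have h2 : (2 <= height_exponent j)%N by apply: leq_trans (height_ge j); rewrite addnC.
rewrite -natrB// natr1; apply: truncn_itv.
by rewrite mulr_ge0// (le_trans _ (ltW tau_gt4)).
Qed.

Let height_ge_real j : (level j)%:R + 12 <= (height_exponent j)%:R :> R.
Proof. by rewrite -natrD ler_nat. Qed.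

Lemma level_height j : (level j + 2 * height_exponent j <= level j.+1)%N.
Proof.
rewrite -ltnS -(ltr_nat R) natrD natrM -[ltRHS]natr1.
have := levelS j; have := height_ge_real j.
move: (level j)%:R (height_exponent j)%:R (level j.+1)%:R (ler0n R (level j)).
move=> x h y x0 xh /andP[_ yh].
have : 4 * (h - 2) <= tau * (h - 2) by rewrite ler_wpM2r ?ltW//; lra.
lra.
Qed.

Lemma level_le j : 2 / tau * (level j.+1)%:R + 4 <= (2 * height_exponent j)%:R.
Proof.
have tau0 : 0 < tau by rewrite (lt_trans _ tau_gt4).
have /andP[h _] := levelS j; rewrite natrM.
have : 2 / tau * (level j.+1)%:R <= 2 / tau * (tau * ((height_exponent j)%:R - 2)).
  by rewrite ler_wpM2l// divr_ge0// ltW.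
rewrite [X in _ <= X](_ : _ = 2 * ((height_exponent j)%:R - 2)); last first.
  by field; rewrite gt_eqF.
lra.
Qed.

Lemma level_ge j : tau * ((height_exponent j)%:R - 3) <= (level j.+1)%:R.
Proof.
have := tau_gt4; have /andP[_] := levelS j.
by move: (level j.+1)%:R (height_exponent j)%:R => y h; lra.
Qed.

End Levels.

Section CantorApproximation.
Variables (R : realType) (p n : nat) (lam : R).
Hypotheses (p_prime : prime p) (n_gt0 : (0 < n)%N).
Local Notation K := (Qp R p).
Local Notation norm := (@padic_norm R p).
Local Notation tau := (n%:R * (1 + lam)).
Hypothesis tau_gt4 : 4 < tau.
Local Notation lev := (level tau).
Local Notation m := (height_exponent tau).
Variable S : nat -> seq nat.
Hypothesis S_residues : forall j r, r \in S j -> (r < p ^ (lev j.+1 - lev j))%N /\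
  exists a t, [/\ (0 < a <= p ^ m j)%N, (t <= p ^ m j)%N &
    a * r = t %[mod p ^ (lev j.+1 - lev j)]]%N.

Let p_gt0 : 0 < p%:R :> R. Proof. by rewrite ltr0n prime_gt0. Qed.
Let p_gt1 : 1 < p%:R :> R. Proof. by rewrite ltr1n prime_gt1. Qed.
Let pX_gt0 k : 0 < p%:R ^+ k :> R. Proof. by rewrite exprn_gt0. Qed.

Let lev_le j : (lev j <= lev j.+1)%N.
Proof. by apply: leq_trans (level_height tau_gt4 j); rewrite leq_addr. Qed.

Let branch_lt c j : cantor_branch p lev S c -> (c j < p ^ lev j)%N.
Proof.
move=> [c0 cS]; elim: j => [|j IH]; first by rewrite c0.
have [r rS ->] := cS j; have [rlt _] := S_residues rS.
rewrite -(subnKC (lev_le j)) expnD.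
apply: (@leq_trans (p ^ lev j * r.+1)); first by rewrite mulnS ltn_add2r.
by rewrite leq_mul2l rlt orbT.
Qed.

(** Let r be the residue of t/a.  The child of c given by r contains
    c + p^(lev j) t/a, which is b/a with b = a c + p^(lev j) t. *)
Lemma cantor_set_rational_approx (x : K) j : cantor_set lev S x ->
  norm x <= 1 /\ exists a b : nat, [/\ (0 < a)%N, (a <= p ^ (lev j + m j).+1)%N,
    (b <= p ^ (lev j + m j).+1)%N &
    norm (a%:R * x - b%:R) <= (p%:R ^+ lev j.+1)^-1].
Proof.
move=> [c cb xc]; have := branch_lt j cb; have [c0 cS] := cb => cj; split.
  by have := xc 0%N; rewrite c0 subr0 expr0 invr1.
have [r rS cE] := cS j; have [_ [a [t [/andP[a0 am] tm art]]]] := S_residues rS.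
exists a, (a * c j + p ^ lev j * t)%N; split=> //.
- by rewrite (leq_trans am)// leq_exp2l ?prime_gt1//; lia.
- have pp := prime_gt1 p_prime.
  apply: (@leq_trans (2 * p ^ (lev j + m j))); last first.
    by rewrite expnS leq_mul2r pp orbT.
  rewrite mul2n -addnn expnD; apply: leq_add; last by rewrite leq_mul.
  by rewrite mulnC leq_mul// ltnW.
have -> : a%:R * x - (a * c j + p ^ lev j * t)%:R =
    a%:R * (x - (c j.+1)%:R) + p%:R ^+ lev j * ((a * r)%:Z - t%:Z)%:~R :> K.
  by rewrite cE !natrD !natrM !natrX rmorphB/= -!pmulrn natrM; ring.
apply: padic_normD_le; rewrite padic_normM.
  apply: le_trans (xc j.+1); rewrite ler_piMl ?padic_norm_ge0//.
  by rewrite [a%:R]pmulrn padic_norm_int_le1.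
rewrite padic_norm_pX// -(subnKC (lev_le j)) exprD invfM ler_pM2l ?invr_gt0//.
rewrite padic_norm_int_dvd//; move/eqP: art.
by rewrite -eqz_nat -!modz_nat eqz_mod_dvd.
Qed.

(** The tuple of the a^(n-i) b^i, for b/a as in [cantor_set_rational_approx], is
    bounded by X = p^(h n), where h = lev j + m j + 1.  Its error is at most
    p^(- lev (j+1)), and lev (j+1) / (h n) tends to 1 + lam; the error is nonzero
    because x is irrational. *)
Lemma cantor_set_solvable (x : K) l : cantor_set lev S x ->
  (forall a b : int, a != 0 -> x != b%:~R / a%:~R) -> l < lam ->
  forall X0, exists2 X, X0 <= X & approx_solvable n x l X.
Proof.
move=> xK xQ llam X0.
have n0 : 0 < n%:R :> R by rewrite ltr0n.
set del := n%:R * (lam - l); have del0 : 0 < del by rewrite mulr_gt0// subr_gt0.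
have tau0 : 0 < tau by rewrite (lt_trans _ tau_gt4).
pose j := maxn (Num.bound (tau / del)) (Num.bound `|X0|).
have j1 : tau <= j.+1%:R * del.
  rewrite -ler_pdivrMr// (le_trans (ltW (archi_boundP _)))//.
    by rewrite divr_ge0// ltW.
  by rewrite ler_nat leqW// leq_maxl.
have j2 : X0 <= j%:R.
  rewrite (le_trans (ler_norm _))// (le_trans (ltW (archi_boundP (normr_ge0 _))))//.
  by rewrite ler_nat leq_maxr.
have [x1 [a [b [a0 aH bH abx]]]] := cantor_set_rational_approx j xK.
set h := (lev j + m j).+1 in aH bH.
pose X : R := (p%:R ^+ h) ^+ n.
have aK0 : (a%:R : K) != 0 by rewrite pmulrn padic_intr_eq0 eqz_nat -lt0n.
have nat_le1 k : norm k%:R <= 1 by rewrite pmulrn padic_norm_int_le1.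
exists X.
  apply: (le_trans j2); rewrite /X -exprM -natrX ler_nat.
  have := ltn_expl j (prime_gt1 p_prime) => /ltnW /leq_trans; apply.
  rewrite leq_exp2l ?prime_gt1//; apply: (@leq_trans h); last by rewrite leq_pmulr.
  by rewrite /h ltnW// ltnS (leq_trans (leq_height tau j))// leq_addl.
pose y (i : 'I_n.+1) : int := (a ^ (n - i) * b ^ i)%N.
exists y.
have errE i : (i <= n)%N -> (y ord0)%:~R * x ^+ i - (y (inord i))%:~R =
    a%:R ^+ (n - i) * ((a%:R * x) ^+ i - b%:R ^+ i) :> K.
  move=> i_n; rewrite /y inordK// subn0 expn0 muln1 -!pmulrn natrM !natrX.
  by rewrite mulrBr exprMn mulrA -exprD subnK.
split.
- apply: bigmax_le => [|i _]; first by rewrite exprn_ge0// exprn_ge0// ltW.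
  rewrite /y -pmulrn ger0_norm// /X -!natrX ler_nat.
  have i_n : (i <= n)%N by rewrite -ltnS.
  have expr_le u v k : (u <= v)%N -> (u ^ k <= v ^ k)%N.
    by case: k => // k; rewrite leq_exp2r.
  by rewrite -[X in (_ <= _ ^ X)%N](subnK i_n) expnD leq_mul// expr_le.
- apply: lt_le_trans (le_approx_error x y n_gt0).
  rewrite errE// padic_norm_gt0 !expr1 mulf_neq0 ?expf_neq0// subr_eq0.
  have := xQ a%:Z b%:Z; rewrite -!pmulrn eqz_nat -lt0n a0 => /(_ isT).
  by apply: contra_neq => <-; rewrite mulrAC divff ?mul1r.
apply: (@le_trans _ _ (p%:R ^+ lev j.+1)^-1).
  apply: approx_error_le => [|i i_n]; first by rewrite invr_ge0 ltW.
  rewrite errE// padic_normM (le_trans _ abx)//.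
  apply: le_trans (padic_norm_subX_le i _ _); rewrite ?nat_le1//.
    by rewrite ler_piMl ?padic_norm_ge0// padic_normX// exprn_ile1 ?padic_norm_ge0.
  by rewrite padic_normM mulr_ile1 ?padic_norm_ge0.
rewrite /X -exprM -!powR_mulrn ?(ltW p_gt0)// -powRN -powRrM.
rewrite ler_powR ?(ltW p_gt1)//.
rewrite -[X in _ <= X]opprK lerN2.
have m_ge : j.+1%:R * ((lev j)%:R + 4) <= (m j)%:R - 3 :> R.
  by rewrite lerBrDr -natrD -natrM -natrD ler_nat height_exponent_ge.
have := level_ge tau_gt4 j.
have hE : (h * n)%:R = ((lev j)%:R + 1 + (m j)%:R) * n%:R :> R.
  by rewrite natrM /h -addn1 !natrD addrAC.
rewrite hE.
have : tau * ((lev j)%:R + 4) <= del * ((m j)%:R - 3).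
  apply: (@le_trans _ _ (j.+1%:R * del * ((lev j)%:R + 4))).
    by rewrite ler_wpM2r// addr_ge0.
  by rewrite mulrAC mulrC ler_wpM2l// ltW.
have : 0 <= del * ((lev j)%:R + 4) by rewrite mulr_ge0 ?addr_ge0 ?(ltW del0).
rewrite /del.
move: (lev j)%:R (m j)%:R (lev j.+1)%:R => u v w; lra.
Qed.

End CantorApproximation.

(** * The dimension *)

Section Dimension.
Variables (R : realType) (p n : nat) (lam : R).
Hypotheses (p_prime : prime p) (n_ge2 : (2 <= n)%N) (lam_gt1 : 1 < lam).
Local Notation K := (Qp R p).
Local Notation dim := (2 / (n%:R * (1 + lam))).

Let n_gt0 : (0 < n)%N. Proof. exact: leq_trans n_ge2. Qed.

Let tau_gt4 : 4 < n%:R * (1 + lam).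
Proof.
have : 2 <= n%:R :> R by rewrite ler_nat.
have := lam_gt1; move: (n%:R : R) => N l1 N2.
have : 0 < (N - 2) * 2 + N * (lam - 1) by rewrite ltr_wpDl ?mulr_ge0 ?mulr_gt0//; lra.
lra.
Qed.

Let null_rationals s : 0 < s ->
  null_cover s [set x : K | exists a b : int, x = b%:~R / a%:~R].
Proof.
move=> s0; apply: (@null_cover_subset _ _ _ _ (\bigcup_h \bigcup_k
    [set ((int_pair h k).2%:~R / (int_pair h k).1%:~R : K)])).
  move=> x [a [b ->]]; exists (maxn `|a| `|b|)%N => //.
  have [k _ kE] := int_pair_surj (leq_maxl `|a| `|b|) (leq_maxr `|a| `|b|).
  by exists k => //; rewrite kE.
by apply: null_cover_bigcup => h; apply: null_cover_bigcup => k; exact: null_cover1.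
Qed.

(** The Cantor set of exponent 2 / tau is covered by the set in question, by the
    sets where the exponent is at least lam + 1/(k+1), and by the rational points.
    The last two kinds are null. *)
Lemma not_null_lambda_exponent_eq :
  ~ null_cover dim [set x : K | lambda_exponent n x = lam%:E].
Proof.
pose tau := n%:R * (1 + lam); rewrite -/tau => nE.
have tau4 : 4 < tau by exact: tau_gt4.
have tau0 : 0 < tau by rewrite (lt_trans _ tau4).
have d0 : 0 < 2 / tau by rewrite divr_gt0.
have d1 : 2 / tau <= 1.
  by rewrite ler_pdivrMr// mul1r (le_trans _ (ltW tau4))// ler_nat.
have /choice[S HS] : forall j, exists S : seq nat, let m := height_exponent tau j in
    let Q := (level tau j.+1 - level tau j)%N in
    [/\ uniq [seq r %% p ^ (2 * m) | r <- S]%N,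
    (p ^ (2 * m) <= 8 * size S)%N &
    forall r, r \in S -> (r < p ^ Q)%N /\ exists a t, [/\ (0 < a <= p ^ m)%N,
      (t <= p ^ m)%N & a * r = t %[mod p ^ Q]]%N].
  move=> j; apply: fraction_residues => //.
  by rewrite leq_subRL ?level_height// (leq_trans _ (level_height tau4 j))// leq_addr.
have S_uniq j : uniq [seq r %% p ^ (2 * height_exponent tau j) | r <- S j]%N.
  by have [] := HS j.
have S_size j : (p ^ (2 * height_exponent tau j) <= 8 * size (S j))%N.
  by have [] := HS j.
have S_res j r : r \in S j -> (r < p ^ (level tau j.+1 - level tau j))%N /\
    exists a t, [/\ (0 < a <= p ^ height_exponent tau j)%N,
      (t <= p ^ height_exponent tau j)%N &
      a * r = t %[mod p ^ (level tau j.+1 - level tau j)]]%N.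
  by have [_ _] := HS j; apply.
apply: (@cantor_set_not_null R p (2 / tau) (level tau) (height_exponent tau) S) => //.
- exact: level_height.
- exact: level_le.
pose ge_k k := [set x : K | ((lam + k.+1%:R^-1)%:E <= lambda_exponent n x)%E].
apply: (@null_cover_subset _ _ _ _ ([set x : K | lambda_exponent n x = lam%:E] `|`
  (\bigcup_k ge_k k `|` [set x : K | exists a b : int, x = b%:~R / a%:~R]))); last first.
  apply: null_coverU => //; apply: null_coverU; last exact: null_rationals.
  apply: null_cover_bigcup => k.
  have k0 : 0 < k.+1%:R^-1 :> R by rewrite invr_gt0.
  apply: null_cover_lambda_exponent_ge => //.
    by rewrite (lt_trans lam_gt1)// ltrDl.
  have n0 : 0 < n%:R :> R by rewrite ltr0n.
  rewrite ltr_pM2l// ltf_pV2 ?posrE// /tau; last first.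
    by rewrite mulr_gt0// !addr_gt0// (lt_trans ltr01).
  by rewrite ltr_pM2l// addrA ltrDl.
move=> x xK; have [xQ|xQ] := pselect (exists a b : int, x = b%:~R / a%:~R).
  by right; right.
have lamx : (lam%:E <= lambda_exponent n x)%E.
  apply/lee_subgt0Pr => e e0; apply: ereal_sup_ubound; exists (lam - e) => //.
  apply: (cantor_set_solvable p_prime n_gt0 tau4 S_res xK) => [a b _|].
    by apply/eqP => xab; apply: xQ; exists a, b.
  by rewrite ltrBlDr ltrDl.
have [lamE|ne] := eqVneq (lambda_exponent n x) lam%:E; first by left.
have lt : (lam%:E < lambda_exponent n x)%E by rewrite lt_neqAle eq_sym ne.
suff [k kx] : exists k : nat, ((lam + k.+1%:R^-1)%:E <= lambda_exponent n x)%E.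
  by right; left; exists k.
case: (lambda_exponent n x) lt => [r| |] //.
- rewrite lte_fin -subr_gt0 => lr.
  have [k _ /(_ k (leqnn _)) hk] := near_infty_natSinv_lt (PosNum lr).
  by exists k; rewrite lee_fin -lerBrDl ltW.
- by move=> _; exists 0%N; rewrite leey.
Qed.

(** Both sets of the theorem have this form. *)
Lemma hausdorff_dim_lambda_exponent (A : set K) :
  [set x : K | lambda_exponent n x = lam%:E] `<=` A ->
  A `<=` [set x : K | (lam%:E <= lambda_exponent n x)%E] ->
  hausdorff_dim A = dim%:E.
Proof.
move=> EA AG; apply: hausdorff_dim_eq.
- by rewrite divr_gt0// (lt_trans _ tau_gt4).
- move=> s ds; apply: null_cover_subset AG _.
  exact: null_cover_lambda_exponent_ge.
- by move=> /(null_cover_subset EA); exact: not_null_lambda_exponent_eq.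
Qed.

End Dimension.

Unset Implicit Arguments.

Theorem theorem2p1 (R : realType) (p n : nat) (lambda : R) (p_prime : prime p)
    (n_ge2 : (2 <= n)%N) (lambda_gt1 : 1 < lambda) :
  hausdorff_dim [set xi : Qp R p | (lambda%:E <= lambda_exponent n xi)%E] =
    hausdorff_dim [set xi : Qp R p | lambda_exponent n xi = lambda%:E] /\
  hausdorff_dim [set xi : Qp R p | lambda_exponent n xi = lambda%:E] =
    (2 / (n%:R * (1 + lambda)))%:E.
Proof.
rewrite !(hausdorff_dim_lambda_exponent p_prime n_ge2 lambda_gt1) //;
  by move=> xi /= ->.
Qed.
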